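(* The cactus Thompson group $CV$ admits the following presentation (the generating symbols denoting the elements of $CV$ of the same name). Generators: $x_i$ $(i\ge 0)$; $\sigma_{i,j}$ $(1\le i<j)$; $\tau_{i,j}$ $(1\le i<j)$. Relations: (A) $x_jx_i=x_ix_{j+1}$ $(0\le i<j)$; (B1) $\sigma_{i,j}^2=\tau_{i,j}^2=1$ $(1\le i<j)$; (B2) $\sigma_{i,j}\sigma_{k,l}=\sigma_{k,l}\sigma_{i,j}$ $(1\le i<j<k<l)$; (B3) $\sigma_{i,j}\sigma_{k,l}=\sigma_{i+j-l,i+j-k}\sigma_{i,j}$ $(1\le i\le k<l\le j)$; (B4) $\tau_{i,j}\tau_{k,j}=\sigma_{i,i+j-k}\tau_{i,j}$ $(1\le i<k<j)$; (B5) $\sigma_{i,j}\tau_{k,l}=\tau_{k,l}\sigma_{i,j}$ $(1\le i<j<k<l)$; (B6) $\tau_{i,j}\sigma_{i,l}=\tau_{i+j-l,j}\tau_{i,j}$ $(1\le i<l<j)$; (B7) $\tau_{i,j}\sigma_{k,l}=\sigma_{i+j-l,i+j-k}\tau_{i,j}$ $(1\le i<k<l<j)$; (C1) $\sigma_{i,j}x_k=x_k\sigma_{i,j}$ $(1\le i<j\le k)$; (C2) $\sigma_{i,j}x_k=x_{i+j-k-2}\sigma_{i,j+1}\sigma_{k+1,k+2}$ $(1\le i<j,\ i-1\le k\le j-1)$; (C3) $\sigma_{i,j}x_k=x_k\sigma_{i+1,j+1}$ $(2\le i<j,\ 0\le k\le i-2)$; (D1) $\tau_{i,j}x_k=x_{i-1}x_i\cdots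 x_{k-j+i-1}x_{k-j+i}^2\,\tau_{i,k+3}\tau_{j,k+3}$ $(1\le i<j,\ j-1<k)$; (D2) $\tau_{i,j}x_{j-1}=x_{i-1}^2\tau_{i,j+2}\tau_{j,j+2}$ $(1\le i<j)$; (D3) $\tau_{i,j}x_k=x_{i+j-k-2}\tau_{i,j+1}\sigma_{k+1,k+2}$ $(1\le i\le k\le j-2)$; (D4) $\tau_{i,j}x_{i-1}=\tau_{i,j+1}\sigma_{i,i+1}$ $(1\le i<j)$; (D5) $\tau_{i,j}x_k=x_k\tau_{i+1,j+1}$ $(2\le i<j,\ 0\le k\le i-2)$.
   Context: Trees. A rooted binary tree is a single vertex or a finite rooted tree in which every non-leaf vertex has a left child and a right child; its $n$ leaves are numbered $1,\dots,n$ from left to right. A caret is the rooted binary tree with two leaves. Attaching a caret to a leaf means identifying the root of the caret with that leaf. Cactus groups. $J_1=\{1\}$; for $n\ge2$, $J_n$ is generated by $s_{i,j}$ $(1\le i<j\le n)$ with relations $s_{i,j}^2=1$; $s_{i,j}s_{k,l}=s_{k,l}s_{i,j}$ for $i<j<k<l$; $s_{i,j}s_{k,l}=s_{i+j-l,i+j-k}s_{i,j}$ for $i\le k<l\le j$. The homomorphism $\pi_n:J_n\to S_n$ sends $s_{i,j}$ to the permutation $m\mapsto i+j-m$ for $i\le m\le j$, fixing all other $m$. Permutations are composed left to right: $(\sigma\tau)(m)=\tau(\sigma(m))$. The group $CV$. A cactus-tree pair is a triple $(T_+,s,T_-)$ with $T_\pm$ rooted binary trees with the same number $n$ of leaves and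 $s\in J_n$. For $1\le i\le n$, writing $s=s_{j_1,k_1}\cdots s_{j_l,k_l}$, put $p_1=i$ and let $p_{m+1}$ be the image of $p_m$ under $\pi_n(s_{j_m,k_m})$. Set $s'=s'_1\cdots s'_l\in J_{n+1}$, where $s'_m=s_{j_m,k_m}$ if $k_m<p_m$; $s'_m=s_{p_m,p_m+1}s_{j_m,k_m+1}$ if $j_m\le p_m\le k_m$; $s'_m=s_{j_m+1,k_m+1}$ if $p_m<j_m$. Attaching a caret to leaf $i$ of $T_+$ and to leaf $\pi_n(s)(i)$ of $T_-$ gives $T'_+,T'_-$; the triple $(T'_+,s',T'_-)$ is called an expansion of $(T_+,s,T_-)$. $CV$ is the set of cactus-tree pairs modulo the equivalence relation generated by expansions. Product: given two classes, choose representatives $(S_+,s,S_-)$, $(T_+,t,T_-)$ with $S_-=T_+$; the product is the class of $(S_+,st,T_-)$. The identity is the class of $(T,1,T)$ and the inverse of $(T_+,s,T_-)$ is $(T_-,s^{-1},T_+)$. Elements. $R_1$ is the one-vertex tree, $R_2$ the caret, and $R_n$ is obtained from $R_{n-1}$ by attaching a caret to its right-most leaf. In $CV$: $x_i=(A_i,1,R_{i+3})$ $(i\ge0)$, where $A_i$ is $R_{i+2}$ with a caret attached to leaf $i+1$; $\sigma_{i,j}=(R_{j+1},s_{i,j},R_{j+1})$ and $\tau_{i,j}=(R_j,s_{i,j},R_j)$ for $1\le i<j$. *)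

(* Defs.v *)
From HB Require Import structures.
From mathcomp Require Import all_boot zify boolp.
From Stdlib Require Relation_Operators Eqdep_dec.

Set Implicit Arguments.
Unset Strict Implicit.
Unset Printing Implicit Defensive.

Local Open Scope quotient_scope.
Local Open Scope group_scope.

(* A letter [(x, true)] is the generator [x], and [(x, false)] its inverse. *)
Notation word X := (seq (X * bool)).

Section Presented.
Variables (X : choiceType) (R : word X -> word X -> Prop).

(* The smallest congruence on words which contains R and free cancellation. *)
Inductive word_eq : word X -> word X -> Prop :=
| word_eq_refl u : word_eq u u
| word_eq_sym u v : word_eq u v -> word_eq v u
| word_eq_trans u v w : word_eq u v -> word_eq v w -> word_eq u w
| word_eq_cancel u x b v :
    word_eq (u ++ [:: (x, b); (x, ~~ b)] ++ v) (u ++ v)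
| word_eq_rel u l r v : R l r -> word_eq (u ++ l ++ v) (u ++ r ++ v).

Definition word_eqb (u v : word X) : bool := `[< word_eq u v >].

Lemma word_eqb_refl : reflexive word_eqb.
Proof. by move=> u; apply/asboolP/word_eq_refl. Qed.

Lemma word_eqb_sym : symmetric word_eqb.
Proof.
by move=> u v; apply/asboolP/asboolP => uv; apply: word_eq_sym.
Qed.

Lemma word_eqb_trans : transitive word_eqb.
Proof.
move=> v u w /asboolP uv /asboolP vw; apply/asboolP.
exact: word_eq_trans uv vw.
Qed.

Canonical word_eqb_equiv :=
  EquivRel word_eqb word_eqb_refl word_eqb_sym word_eqb_trans.

Definition presented := {eq_quot word_eqb}.
HB.instance Definition _ := Choice.on presented.

Definition pword (u : word X) : presented := \pi u.
Definition pgen (x : X) : presented := pword [:: (x, true)].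

Lemma pwordP u v : pword u = pword v <-> word_eq u v.
Proof.
split=> [|uv]; last by apply/eqmodP/asboolP.
by move=> /eqmodP /asboolP.
Qed.

Lemma pword_surj (g : presented) : exists u, g = pword u.
Proof. by exists (repr g); rewrite /pword reprK. Qed.

Lemma word_eq_cat u u' v v' :
  word_eq u u' -> word_eq v v' -> word_eq (u ++ v) (u' ++ v').
Proof.
have catl w x y : word_eq x y -> word_eq (w ++ x) (w ++ y).
  elim=> {x y} [x|x y _|x y z _ + _|x a b y|x l r y lr].
  - exact: word_eq_refl.
  - exact: word_eq_sym.
  - exact: word_eq_trans.
  - by have := word_eq_cancel (w ++ x) a b y; rewrite -!catA.
  - by have := word_eq_rel (w ++ x) y lr; rewrite -!catA.
have catr w x y : word_eq x y -> word_eq (x ++ w) (y ++ w).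
  elim=> {x y} [x|x y _|x y z _ + _|x a b y|x l r y lr].
  - exact: word_eq_refl.
  - exact: word_eq_sym.
  - exact: word_eq_trans.
  - by have := word_eq_cancel x a b (y ++ w); rewrite -!catA.
  - by have := word_eq_rel x (y ++ w) lr; rewrite -!catA.
by move=> uu' vv'; apply: word_eq_trans (catr _ _ _ uu') (catl _ _ _ vv').
Qed.

Definition word_inv (u : word X) : word X := rev [seq (a.1, ~~ a.2) | a <- u].

Lemma word_inv_cat u v : word_inv (u ++ v) = word_inv v ++ word_inv u.
Proof. by rewrite /word_inv map_cat rev_cat. Qed.

Lemma word_invK : involutive word_inv.
Proof.
move=> u; rewrite /word_inv map_rev revK -map_comp -[RHS]map_id.
by apply: eq_map => -[x b] /=; rewrite negbK.
Qed.

Lemma word_eq_mulV u : word_eq (u ++ word_inv u) [::].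
Proof.
elim: u => [|[x b] u IHu] /=; first exact: word_eq_refl.
rewrite [word_inv _](_ : _ = word_inv u ++ [:: (x, ~~ b)]); last first.
  by rewrite -cat1s word_inv_cat.
apply: word_eq_trans (word_eq_cancel [::] x b [::]).
have -> : (x, b) :: u ++ word_inv u ++ [:: (x, ~~ b)] =
    [:: (x, b)] ++ ((u ++ word_inv u) ++ [:: (x, ~~ b)]) by rewrite /= -catA.
apply: (@word_eq_cat [:: (x, b)] [:: (x, b)]) (word_eq_refl _) _.
exact: (word_eq_cat IHu (word_eq_refl _)).
Qed.

Lemma word_eq_mulI u : word_eq (word_inv u ++ u) [::].
Proof. by have := word_eq_mulV (word_inv u); rewrite word_invK. Qed.

Lemma word_eq_inv u v : word_eq u v -> word_eq (word_inv u) (word_inv v).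
Proof.
move=> uv.
apply: (@word_eq_trans _ (word_inv u ++ (v ++ word_inv v))).
  rewrite -{1}[word_inv u]cats0; apply: word_eq_cat (word_eq_refl _) _.
  exact/word_eq_sym/word_eq_mulV.
rewrite catA -[X in word_eq _ X]cat0s.
apply: word_eq_cat (word_eq_refl _).
apply: word_eq_trans (word_eq_mulI u).
exact: word_eq_cat (word_eq_refl _) (word_eq_sym uv).
Qed.

Definition pmul (g h : presented) := pword (repr g ++ repr h).
Definition pinv (g : presented) := pword (word_inv (repr g)).

Lemma repr_pword u : word_eq (repr (pword u)) u.
Proof. by apply/pwordP; rewrite /pword reprK. Qed.

Lemma pmulE u v : pmul (pword u) (pword v) = pword (u ++ v).
Proof. by apply/pwordP; apply: word_eq_cat; apply: repr_pword. Qed.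

Lemma pinvE u : pinv (pword u) = pword (word_inv u).
Proof. by apply/pwordP/word_eq_inv/repr_pword. Qed.

Lemma pmulA : associative pmul.
Proof.
move=> g h k; have [u ->] := pword_surj g; have [v ->] := pword_surj h.
by have [w ->] := pword_surj k; rewrite !pmulE catA.
Qed.

Lemma pmul1g : left_id (pword [::]) pmul.
Proof. by move=> g; have [u ->] := pword_surj g; rewrite pmulE. Qed.

Lemma pmulg1 : right_id (pword [::]) pmul.
Proof. by move=> g; have [u ->] := pword_surj g; rewrite pmulE cats0. Qed.

Lemma pmulVg : left_inverse (pword [::]) pinv pmul.
Proof.
move=> g; have [u ->] := pword_surj g; rewrite pinvE pmulE.
by apply/pwordP/word_eq_mulI.
Qed.

Lemma pmulgV : right_inverse (pword [::]) pinv pmul.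
Proof.
move=> g; have [u ->] := pword_surj g; rewrite pinvE pmulE.
by apply/pwordP/word_eq_mulV.
Qed.

HB.instance Definition _ :=
  isGroup.Build presented pmulA pmul1g pmulg1 pmulVg pmulgV.

Lemma pword_cat u v : pword (u ++ v) = pword u * pword v.
Proof. by rewrite -pmulE. Qed.

Lemma pword_rel u v : R u v -> pword u = pword v.
Proof.
move=> uv; apply/pwordP; have := word_eq_rel [::] [::] uv.
by rewrite /= !cats0.
Qed.

Lemma pgenV x : pword [:: (x, false)] = (pgen x)^-1.
Proof. by rewrite [RHS]pinvE. Qed.

End Presented.


(* Indices (i, j) with 1 <= i < j <= n. *)
Definition cactus_gen (n : nat) :=
  {p : nat * nat | (0 < p.1 < p.2)%N && (p.2 <= n)%N}.
HB.instance Definition _ n := SubChoice.on (cactus_gen n).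

(* The letter s_{i,j}; [::] is a junk value, for indices out of range. *)
Definition cactus_letter n (i j : nat) : word (cactus_gen n) :=
  if insub (i, j) is Some a then [:: (a : cactus_gen n, true)] else [::].

Inductive cactus_rel n : word (cactus_gen n) -> word (cactus_gen n) -> Prop :=
| cactus_rel_sq i j : (1 <= i < j)%N -> (j <= n)%N ->
    cactus_rel (cactus_letter n i j ++ cactus_letter n i j) [::]
| cactus_rel_disjoint i j k l :
    (1 <= i < j)%N -> (j < k < l)%N -> (l <= n)%N ->
    cactus_rel (cactus_letter n i j ++ cactus_letter n k l)
               (cactus_letter n k l ++ cactus_letter n i j)
| cactus_rel_nested i j k l :
    (1 <= i <= k)%N -> (k < l <= j)%N -> (j <= n)%N ->
    cactus_rel (cactus_letter n i j ++ cactus_letter n k l)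
               (cactus_letter n (i + j - l) (i + j - k) ++ cactus_letter n i j).

Definition J (n : nat) := presented (@cactus_rel n).
HB.instance Definition _ n := Group.on (J n).

(* s_{i,j} for 1 <= i < j <= n; [1] is a junk value. *)
Definition cs n (i j : nat) : J n := pword _ (cactus_letter n i j).

Definition cactus_prod n (w : seq (cactus_gen n)) : J n :=
  \prod_(a <- w) pgen _ a.

(* The image of p under pi_n(s_{j,k}). *)
Definition gen_pos (a : nat * nat) (p : nat) : nat :=
  if (a.1 <= p <= a.2)%N then (a.1 + a.2 - p)%N else p.

(* The image of p under pi_n(s_{j_1,k_1} ... s_{j_l,k_l}), permutations being
   composed from left to right. *)
Definition word_pos n (w : seq (cactus_gen n)) (p : nat) : nat :=
  foldl (fun q a => gen_pos (val a) q) p w.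

(* The factor s'_m of s' coming from the letter s_{j,k} = a, when p_m = p. *)
Definition gen_expand n (a : nat * nat) (p : nat) : J n.+1 :=
  if (a.2 < p)%N then cs n.+1 a.1 a.2
  else if (a.1 <= p)%N then cs n.+1 p p.+1 * cs n.+1 a.1 a.2.+1
  else cs n.+1 a.1.+1 a.2.+1.

Fixpoint word_expand n (w : seq (cactus_gen n)) (p : nat) : J n.+1 :=
  if w is a :: w' then
    gen_expand n (val a) p * word_expand w' (gen_pos (val a) p)
  else 1.

Section CactusTheory.
Variable n : nat.
Implicit Types (i j k l p q : nat) (a : cactus_gen n) (s t : J n).

Lemma cactus_genP a : (0 < (val a).1 < (val a).2)%N && ((val a).2 <= n)%N.
Proof. exact: (valP a). Qed.

Lemma cactus_letterE i j : (0 < i < j)%N -> (j <= n)%N ->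
  exists2 a, val a = (i, j) & cactus_letter n i j = [:: (a, true)].
Proof.
move=> ij jn; have H : (0 < (i, j).1 < (i, j).2)%N && ((i, j).2 <= n)%N.
  by rewrite ij.
by exists (Sub (i, j) H : cactus_gen n); rewrite // /cactus_letter insubT.
Qed.

Lemma cactus_letter_out i j :
  ~~ ((0 < i < j)%N && (j <= n)%N) -> cactus_letter n i j = [::].
Proof. by move=> H; rewrite /cactus_letter insubF //; apply: negbTE. Qed.

Lemma cs_out i j : ~~ ((0 < i < j)%N && (j <= n)%N) -> cs n i j = 1.
Proof. by move=> H; rewrite /cs cactus_letter_out. Qed.

Lemma cs_val a : cs n (val a).1 (val a).2 = pgen _ a.
Proof.
have /andP[a1 a2] := cactus_genP a.
have [b vb e] := cactus_letterE a1 a2.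
have -> : a = b by apply: val_inj; rewrite vb; case: (val a).
by rewrite vb /cs e.
Qed.

Lemma csK i j : cs n i j * cs n i j = 1.
Proof.
have [/andP[ij jn]|/cs_out ->] := boolP ((0 < i < j)%N && (j <= n)%N).
  by rewrite -pword_cat; apply: pword_rel; constructor.
exact: mulg1.
Qed.

Lemma cs_disjoint i j k l : (j < k)%N ->
  cs n i j * cs n k l = cs n k l * cs n i j.
Proof.
move=> jk; have [/andP[ij jn]|/cs_out ->] := boolP ((0 < i < j)%N && (j <= n)%N).
  have [/andP[kl ln]|/cs_out ->] := boolP ((0 < k < l)%N && (l <= n)%N).
    rewrite -!pword_cat; apply: pword_rel; constructor => //.
    by rewrite jk; case/andP: kl.
  by rewrite mulg1 mul1g.
by rewrite mulg1 mul1g.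
Qed.

Lemma cs_nested i j k l : (0 < i <= k)%N -> (k < l <= j)%N -> (j <= n)%N ->
  cs n i j * cs n k l = cs n (i + j - l) (i + j - k) * cs n i j.
Proof. by move=> *; rewrite -!pword_cat; apply: pword_rel; constructor. Qed.

Lemma pgenK a : pgen (@cactus_rel n) a * pgen _ a = 1.
Proof. by rewrite -cs_val csK. Qed.

Lemma pgen_inv a : (pgen (@cactus_rel n) a)^-1 = pgen _ a.
Proof. by rewrite -[LHS]mulg1 -(pgenK a) mulgA mulVg mul1g. Qed.

Lemma cactus_prod_cat w w' :
  cactus_prod (w ++ w') = cactus_prod w * cactus_prod w' :> J n.
Proof. by rewrite /cactus_prod big_cat. Qed.

(* s_{i,j} is an involution, so that a word may be stripped of its signs *)
Lemma pword_unsign (u : word (cactus_gen n)) :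
  pword _ u = cactus_prod [seq x.1 | x <- u].
Proof.
elim: u => [|[a b] u IHu]; first by rewrite /cactus_prod big_nil.
rewrite -cat1s pword_cat map_cat cactus_prod_cat -IHu; congr (_ * _).
rewrite /cactus_prod big_seq1; case: b => //.
by rewrite pgenV pgen_inv.
Qed.

Lemma cactus_prod_surj s : exists w, s = cactus_prod w.
Proof. by have [u ->] := pword_surj s; rewrite pword_unsign; eexists. Qed.

Lemma word_pos_cat (w w' : seq (cactus_gen n)) p :
  word_pos (w ++ w') p = word_pos w' (word_pos w p).
Proof. by rewrite /word_pos foldl_cat. Qed.

Lemma word_expand_cat (w w' : seq (cactus_gen n)) p : word_expand (w ++ w') p =
  word_expand w p * word_expand w' (word_pos w p).
Proof.
elim: w p => [|a w IHw] p /=; first by rewrite mul1g.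
by rewrite IHw mulgA.
Qed.

End CactusTheory.

Section Generators.
Variable n : nat.
Implicit Types i j k l p q : nat.

Lemma gen_pos_in i j p : (i <= p <= j)%N -> gen_pos (i, j) p = (i + j - p)%N.
Proof. by rewrite /gen_pos /= => ->. Qed.

Lemma gen_pos_out i j p : ~~ (i <= p <= j)%N -> gen_pos (i, j) p = p.
Proof. by rewrite /gen_pos /= => /negbTE ->. Qed.

Lemma gen_expand_gt i j p : (j < p)%N -> gen_expand n (i, j) p = cs n.+1 i j.
Proof. by rewrite /gen_expand /= => ->. Qed.

Lemma gen_expand_in i j p : (i <= p <= j)%N ->
  gen_expand n (i, j) p = cs n.+1 p p.+1 * cs n.+1 i j.+1.
Proof. by rewrite /gen_expand /= ltnNge => /andP[-> ->]. Qed.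

Lemma gen_expand_lt i j p : (i < j)%N -> (p < i)%N ->
  gen_expand n (i, j) p = cs n.+1 i.+1 j.+1.
Proof.
by move=> ij pi; rewrite /gen_expand /= ltnNge (ltnW (ltn_trans pi ij)) leqNgt pi.
Qed.

End Generators.

Ltac gens := repeat match goal with
  | |- context [gen_pos (?i, ?j) ?p] => first
      [ rewrite (@gen_pos_in i j p); [|lia]
      | rewrite (@gen_pos_out i j p); [|lia] ]
  | |- context [gen_expand ?n (?i, ?j) ?p] => first
      [ rewrite (@gen_expand_gt n i j p); [|lia]
      | rewrite (@gen_expand_in n i j p); [|lia]
      | rewrite (@gen_expand_lt n i j p); [|lia..] ]
  end.

Section GeneratorRelations.
Variable n : nat.
Implicit Types i j k l p q : nat.

Lemma gen_posK i j p : gen_pos (i, j) (gen_pos (i, j) p) = p.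
Proof.
have [H|H] := boolP (i <= p <= j)%N; gens; lia.
Qed.

Lemma gen_pos_bound i j p : (0 < i < j)%N && (j <= n)%N -> (0 < p <= n)%N ->
  (0 < gen_pos (i, j) p <= n)%N.
Proof.
by move=> ijn pn; have [H|H] := boolP (i <= p <= j)%N; gens; lia.
Qed.

Lemma gen_expandK i j p : (0 < i < j)%N -> (j <= n)%N ->
  gen_expand n (i, j) p * gen_expand n (i, j) (gen_pos (i, j) p) = 1.
Proof.
move=> ij jn; have [jp|pj] := ltnP j p; first by gens; exact: csK.
have [ip|pi] := leqP i p; last by gens; exact: csK.
gens; rewrite -mulgA (mulgA (cs _ i _)) cs_nested; [|lia..].
rewrite (_ : (i + j.+1 - (i + j - p).+1 = p)%N); last lia.
rewrite (_ : (i + j.+1 - (i + j - p) = p.+1)%N); last lia.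
by rewrite -mulgA csK mulg1 csK.
Qed.

Lemma gen_pos_disjoint i j k l p : (j < k)%N ->
  gen_pos (k, l) (gen_pos (i, j) p) = gen_pos (i, j) (gen_pos (k, l) p).
Proof.
move=> jk; have [H|H] := boolP (i <= p <= j)%N; first by gens.
by have [H'|H'] := boolP (k <= p <= l)%N; gens.
Qed.

Lemma gen_expand_disjoint i j k l p :
  (0 < i < j)%N -> (j < k < l)%N -> (l <= n)%N ->
  gen_expand n (i, j) p * gen_expand n (k, l) (gen_pos (i, j) p) =
  gen_expand n (k, l) p * gen_expand n (i, j) (gen_pos (k, l) p).
Proof.
move=> ij kl ln; have [pi|ip] := ltnP p i.
  by gens; apply: cs_disjoint; lia.
have [pj|jp] := leqP p j.
  gens; rewrite -!mulgA (@cs_disjoint n.+1 i); last lia.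
  rewrite !mulgA; congr (_ * _); apply: cs_disjoint; lia.
have [pk|kp] := ltnP p k; first by gens; apply: cs_disjoint; lia.
have [pl|lp] := leqP p l; last by gens; apply: cs_disjoint; lia.
gens; rewrite -!mulgA -(@cs_disjoint n.+1 i j k); last lia.
rewrite !mulgA; congr (_ * _); apply: cs_disjoint; lia.
Qed.

Lemma gen_pos_nested i j k l p :
  (0 < i <= k)%N -> (k < l <= j)%N ->
  gen_pos (k, l) (gen_pos (i, j) p) =
  gen_pos (i, j) (gen_pos (i + j - l, i + j - k)%N p).
Proof.
move=> ik kl; have [H|H] := boolP (i <= p <= j)%N; last by gens.
by have [H'|H'] := boolP (i + j - l <= p <= i + j - k)%N; gens; lia.
Qed.

Lemma gen_expand_nested i j k l p :
  (0 < i <= k)%N -> (k < l <= j)%N -> (j <= n)%N ->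
  gen_expand n (i, j) p * gen_expand n (k, l) (gen_pos (i, j) p) =
  gen_expand n (i + j - l, i + j - k)%N p *
    gen_expand n (i, j) (gen_pos (i + j - l, i + j - k)%N p).
Proof.
move=> ik kl jn; have [pi|ip] := ltnP p i.
  by gens; rewrite cs_nested; [|lia..]; congr (cs _ _ _ * _); lia.
have [pj|jp] := leqP p j; last first.
  by gens; rewrite cs_nested; [|lia..].
have [H|H] := ltnP p (i + j - l)%N.
  gens; rewrite -mulgA (@cs_nested n.+1 i j.+1 k l); [|lia..].
  rewrite !mulgA (_ : i + j.+1 - l = (i + j - l).+1)%N; last lia.
  rewrite (_ : i + j.+1 - k = (i + j - k).+1)%N; last lia.
  by congr (_ * _); apply: cs_disjoint; lia.
have [H'|H'] := ltnP (i + j - k)%N p.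
  gens; rewrite -mulgA (@cs_nested n.+1 i j.+1 k.+1 l.+1); [|lia..].
  rewrite !mulgA (_ : i + j.+1 - l.+1 = (i + j - l))%N; last lia.
  rewrite (_ : i + j.+1 - k.+1 = (i + j - k))%N; last lia.
  by congr (_ * _); apply/esym/cs_disjoint; lia.
gens; set q := (i + j - p)%N; set r := (_ + _ - p)%N.
rewrite -!mulgA (mulgA (cs _ i j.+1)) (@cs_nested n.+1 i j.+1 q q.+1); [|lia..].
rewrite -!mulgA (@cs_nested n.+1 i j.+1); [|lia..].
rewrite (_ : i + j.+1 - q.+1 = p)%N; last lia.
rewrite (_ : i + j.+1 - q = p.+1)%N; last lia.
rewrite (_ : i + j.+1 - l.+1 = i + j - l)%N; last lia.
rewrite (_ : i + j.+1 - k = (i + j - k).+1)%N; last lia.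
rewrite (mulgA (cs _ p _)) csK mul1g.
rewrite (mulgA (cs _ (i + j - l) _) (cs _ r _)).
rewrite (@cs_nested n.+1 (i + j - l)%N _ r r.+1); [|lia..].
rewrite (_ : i + j - l + (i + j - k).+1 - r.+1 = p)%N; last lia.
rewrite (_ : i + j - l + (i + j - k).+1 - r = p.+1)%N; last lia.
rewrite -!mulgA (mulgA (cs _ p _)).
by rewrite csK mul1g.
Qed.

(* Expansions at distinct leaves commute; [shift p q] is the new number of
   leaf [q] once leaf [p] has been split. *)
Definition shift p q := if (p < q)%N then q.+1 else q.

Lemma shift_lt p q : (p < q)%N -> shift p q = q.+1.
Proof. by rewrite /shift => ->. Qed.

Lemma shift_ge p q : (q <= p)%N -> shift p q = q.
Proof. by rewrite /shift ltnNge => ->. Qed.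

End GeneratorRelations.

Definition rels_ok n (w w' : seq (cactus_gen n)) := forall p,
  word_pos w p = word_pos w' p /\ word_expand w p = word_expand w' p.

Lemma rels_ok_cat n (w1 w2 w1' w2' : seq (cactus_gen n)) :
  rels_ok w1 w1' -> rels_ok w2 w2' -> rels_ok (w1 ++ w2) (w1' ++ w2').
Proof.
move=> h1 h2 p; have [e1 e1'] := h1 p; have [e2 e2'] := h2 (word_pos w1' p).
by rewrite !word_pos_cat !word_expand_cat e1 e1' e2 e2'.
Qed.

Lemma rels_ok_refl n (w : seq (cactus_gen n)) : rels_ok w w.
Proof. by []. Qed.

Lemma rels_ok_sq n (a : cactus_gen n) : rels_ok [:: a; a] [::].
Proof.
have /andP := cactus_genP a; move=> + p; rewrite /= mulg1.
case: (val a) => i j [/= ij jn].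
by rewrite gen_posK gen_expandK.
Qed.

Definition unsign n (u : word (cactus_gen n)) : seq (cactus_gen n) :=
  [seq x.1 | x <- u].

Lemma unsign_cat n (u v : word (cactus_gen n)) :
  unsign (u ++ v) = unsign u ++ unsign v.
Proof. exact: map_cat. Qed.

Lemma word_eq_ok n (u v : word (cactus_gen n)) :
  word_eq (@cactus_rel n) u v -> rels_ok (unsign u) (unsign v).
Proof.
elim=> {u v} [u|u v _ IH p|u v w _ IH1 _ IH2 p|u a b v|u l r v lr].
- exact: rels_ok_refl.
- by have [-> ->] := IH p.
- by have [-> ->] := IH1 p; apply: IH2.
- rewrite !unsign_cat; apply: rels_ok_cat; first exact: rels_ok_refl.
  rewrite -[X in rels_ok _ X]cat0s; apply: rels_ok_cat (rels_ok_refl _).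
  exact: rels_ok_sq.
rewrite !unsign_cat; apply: rels_ok_cat; first exact: rels_ok_refl.
apply: rels_ok_cat (rels_ok_refl _) => {u v}.
case: lr => [i j ij jn|i j k l' ij kl ln|i j k l' ik kl jn].
- by have [a _ ->] := cactus_letterE ij jn; apply: rels_ok_sq.
- have jn : (j <= n)%N by lia.
  have [a va ->] := cactus_letterE ij jn.
  have kl' : (0 < k < l')%N by lia.
  have [b vb ->] := cactus_letterE kl' ln => p.
  rewrite /= va vb !mulg1; split; first by apply: gen_pos_disjoint; lia.
  exact: gen_expand_disjoint.
have ij : (0 < i < j)%N by lia.
have kl' : (0 < k < l')%N by lia.
have ln : (l' <= n)%N by lia.
have cd : (0 < i + j - l' < i + j - k)%N by lia.
have dn : (i + j - k <= n)%N by lia.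
have [a va ->] := cactus_letterE ij jn; have [b vb ->] := cactus_letterE kl' ln.
have [c vc ->] := cactus_letterE cd dn => p.
rewrite /= va vb vc !mulg1; split; first exact: gen_pos_nested.
exact: gen_expand_nested.
Qed.

Section ExpandElement.
Variable n : nat.
Implicit Types (s t : J n) (i j p q : nat).

Definition Jpos s p : nat := word_pos (unsign (repr s)) p.
Definition Jexpand s p : J n.+1 := word_expand (unsign (repr s)) p.

Lemma cactus_prodE (w : seq (cactus_gen n)) :
  cactus_prod w = pword _ [seq (a, true) | a <- w].
Proof.
rewrite pword_unsign -map_comp; congr cactus_prod.
by rewrite -[LHS]map_id; apply: eq_map.
Qed.

Lemma Jword_ok (w : seq (cactus_gen n)) :
  rels_ok (unsign (repr (cactus_prod w))) w.
Proof.
have := word_eq_ok (repr_pword (@cactus_rel n) [seq (a, true) | a <- w]).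
by rewrite -cactus_prodE {2}/unsign -map_comp map_id.
Qed.

Lemma Jpos_prod (w : seq (cactus_gen n)) p : Jpos (cactus_prod w) p = word_pos w p.
Proof. by have [] := Jword_ok w p. Qed.

Lemma Jexpand_prod (w : seq (cactus_gen n)) p :
  Jexpand (cactus_prod w) p = word_expand w p.
Proof. by have [] := Jword_ok w p. Qed.

Lemma cactus_prod1 : 1 = cactus_prod [::] :> J n.
Proof. by rewrite /cactus_prod big_nil. Qed.

Lemma Jpos1 p : Jpos 1 p = p.
Proof. by rewrite cactus_prod1 Jpos_prod. Qed.

Lemma Jexpand1 p : Jexpand 1 p = 1.
Proof. by rewrite cactus_prod1 Jexpand_prod. Qed.

Lemma JposM s t p : Jpos (s * t) p = Jpos t (Jpos s p).
Proof.
have [v ->] := cactus_prod_surj s; have [w ->] := cactus_prod_surj t.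
by rewrite -cactus_prod_cat !Jpos_prod word_pos_cat.
Qed.

Lemma JexpandM s t p : Jexpand (s * t) p = Jexpand s p * Jexpand t (Jpos s p).
Proof.
have [v ->] := cactus_prod_surj s; have [w ->] := cactus_prod_surj t.
by rewrite -cactus_prod_cat !Jexpand_prod Jpos_prod word_expand_cat.
Qed.

Lemma Jpos_cs i j p : (0 < i < j)%N -> (j <= n)%N ->
  Jpos (cs n i j) p = gen_pos (i, j) p.
Proof.
move=> ij jn; have [a va e] := cactus_letterE ij jn.
by rewrite /cs e pword_unsign Jpos_prod /= va.
Qed.

Lemma Jexpand_cs i j p : (0 < i < j)%N -> (j <= n)%N ->
  Jexpand (cs n i j) p = gen_expand n (i, j) p.
Proof.
move=> ij jn; have [a va e] := cactus_letterE ij jn.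
by rewrite /cs e pword_unsign Jexpand_prod /= va mulg1.
Qed.

Lemma Jpos_bound s p : (0 < p <= n)%N -> (0 < Jpos s p <= n)%N.
Proof.
have [w ->] := cactus_prod_surj s; rewrite Jpos_prod.
elim: w p => [//|a w IHw] p Hp; apply: (IHw (gen_pos (val a) p)).
have := cactus_genP a; case: (val a) => i j H; exact: gen_pos_bound H Hp.
Qed.

Lemma JposK s p : Jpos s^-1 (Jpos s p) = p.
Proof. by rewrite -JposM mulgV Jpos1. Qed.

Lemma JposVK s p : Jpos s (Jpos s^-1 p) = p.
Proof. by rewrite -JposM mulVg Jpos1. Qed.

Lemma JexpandV s p : Jexpand s^-1 (Jpos s p) = (Jexpand s p)^-1.
Proof.
have : Jexpand s p * Jexpand s^-1 (Jpos s p) = 1.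
  by rewrite -JexpandM mulgV Jexpand1.
by move=> e; rewrite -[LHS]mul1g -(mulVg (Jexpand s p)) -mulgA e mulg1.
Qed.

End ExpandElement.

Lemma J_ind n (P : J n -> Prop) :
  P 1 ->
  (forall i j s, (0 < i < j)%N -> (j <= n)%N -> P s -> P (cs n i j * s)) ->
  forall s, P s.
Proof.
move=> P1 PM s; have [w ->] := cactus_prod_surj s.
elim: w => [|a w IHw]; first by rewrite -cactus_prod1.
rewrite -cat1s cactus_prod_cat {1}/cactus_prod big_seq1 -cs_val.
by have /andP[] := cactus_genP a; move=> *; apply: PM.
Qed.

Section ExpandCommute.
Variable n : nat.
Implicit Types (s t : J n) (i j p q : nat).

Ltac cspos := rewrite ?JposM; repeat (rewrite Jpos_cs; [|lia|lia]).

Lemma shift_gen i j p q : (0 < i < j)%N -> (j <= n)%N ->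
  (0 < p <= n)%N -> p <> q ->
  Jpos (gen_expand n (i, j) p) (shift p q) =
  shift (gen_pos (i, j) p) (gen_pos (i, j) q).
Proof.
move=> ij jn pn pq; have [q1|q1] := ltnP p q.
  rewrite (shift_lt q1); have [jp|pj] := ltnP j p.
    by gens; cspos; gens; rewrite shift_lt.
  have [ip|pi] := leqP i p; last first.
    gens; cspos; have [H|H] := boolP (i <= q <= j)%N; gens.
      by rewrite shift_lt; lia.
    by rewrite shift_lt; lia.
  gens; cspos; have [H|H] := boolP (i <= q <= j)%N; gens.
    by rewrite shift_ge; lia.
  by rewrite shift_lt; lia.
rewrite (shift_ge q1); have [jp|pj] := ltnP j p.
  gens; cspos; have [H|H] := boolP (i <= q <= j)%N; gens.
    by rewrite shift_ge; lia.
  by rewrite shift_ge; lia.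
have [ip|pi] := leqP i p; last first.
  by gens; cspos; gens; rewrite shift_ge; lia.
gens; cspos; have [H|H] := boolP (i <= q <= j)%N; gens.
  by rewrite shift_lt; lia.
by rewrite shift_ge; lia.
Qed.

Lemma Jpos_inj s p q : Jpos s p = Jpos s q -> p = q.
Proof. by move=> /(congr1 (Jpos s^-1)); rewrite !JposK. Qed.

Lemma Jpos_shift s p q : (0 < p <= n)%N -> (0 < q <= n)%N -> p <> q ->
  Jpos (Jexpand s p) (shift p q) = shift (Jpos s p) (Jpos s q).
Proof.
elim/J_ind: s p q => [|i j s ij jn IHs] p q pn qn pq.
  by rewrite Jexpand1 !Jpos1.
rewrite JexpandM !JposM Jexpand_cs // !Jpos_cs // shift_gen // IHs //.
- by rewrite -(Jpos_cs _ ij jn) Jpos_bound.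
- by rewrite -(Jpos_cs _ ij jn) Jpos_bound.
by rewrite -!(Jpos_cs _ ij jn) => /Jpos_inj.
Qed.

Lemma gen_expand_shift i j p q : (0 < i < j)%N -> (j <= n)%N ->
  (0 < p)%N -> (p < q)%N -> (q <= n)%N ->
  Jexpand (gen_expand n (i, j) p) (shift p q) =
  Jexpand (gen_expand n (i, j) q) (shift q p).
Proof.
move=> ij jn p0 pq qn; rewrite (shift_lt pq) (shift_ge (ltnW pq)).
have [pi|ip] := ltnP p i.
  have [qi|iq] := ltnP q i.
    by gens; rewrite !Jexpand_cs; [|lia..]; gens.
  have [qj|jq] := leqP q j.
    by gens; rewrite JexpandM; cspos; rewrite !Jexpand_cs; [|lia..]; gens.
  by gens; rewrite !Jexpand_cs; [|lia..]; gens.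
have [pj|jp] := leqP p j; last first.
  by gens; rewrite !Jexpand_cs; [|lia..]; gens.
have [qj|jq] := leqP q j; last first.
  by gens; rewrite JexpandM; cspos; rewrite !Jexpand_cs; [|lia..]; gens.
gens; rewrite !JexpandM; cspos; rewrite !Jexpand_cs; [|lia..]; gens.
rewrite !mulgA; congr (_ * _); apply: cs_disjoint; lia.
Qed.

Lemma Jexpand_shift s p q : (0 < p <= n)%N -> (0 < q <= n)%N -> p <> q ->
  Jexpand (Jexpand s p) (shift p q) = Jexpand (Jexpand s q) (shift q p).
Proof.
elim/J_ind: s p q => [|i j s ij jn IHs] p q pn qn pq.
  by rewrite !Jexpand1.
have qp : q <> p by move/esym.
rewrite !JexpandM Jexpand_cs // Jexpand_cs // !Jpos_cs // !shift_gen //.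
rewrite IHs.
- congr (_ * _); have [lt|lt] : (p < q)%N \/ (q < p)%N by lia.
    by apply: gen_expand_shift; lia.
  by apply/esym/gen_expand_shift; lia.
- by rewrite -(Jpos_cs _ ij jn) Jpos_bound.
- by rewrite -(Jpos_cs _ ij jn) Jpos_bound.
by rewrite -!(Jpos_cs _ ij jn) => /Jpos_inj.
Qed.

End ExpandCommute.


Inductive btree := Leaf | Node of btree & btree.

Fixpoint leaves (T : btree) : nat :=
  if T is Node l r then (leaves l + leaves r)%N else 1%N.

(* Attach a caret to the i-th leaf, 1 <= i <= leaves T. *)
Fixpoint attach_caret (T : btree) (i : nat) : btree :=
  if T is Node l r then
    if (i <= leaves l)%N then Node (attach_caret l i) r
    else Node l (attach_caret r (i - leaves l))
  else Node Leaf Leaf.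

Lemma leaves_attach T i : leaves (attach_caret T i) = (leaves T).+1.
Proof.
elim: T i => //= l IHl r IHr i; case: ifP => _ /=; rewrite ?IHl ?IHr ?addSn //.
by rewrite addnS.
Qed.

Record tree n := Tree { btree_of :> btree; _ : leaves btree_of = n }.

Lemma leaves_tree n (T : tree n) : leaves T = n.
Proof. by case: T. Qed.

Lemma tree_inj n (S T : tree n) : S = T :> btree -> S = T.
Proof.
case: S T => [S hS] [T hT] /= e; case: _ / e hT => hT.
by congr Tree; apply: Prop_irrelevance.
Qed.

Lemma attach_subproof n (T : tree n) i : leaves (attach_caret T i) = n.+1.
Proof. by rewrite leaves_attach leaves_tree. Qed.

Definition attach n (T : tree n) i : tree n.+1 := Tree (attach_subproof T i).

Definition leaf : tree 1 := @Tree 1 Leaf erefl.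

Fixpoint right_vine n : tree n.+1 :=
  if n is m.+1 then attach (right_vine m) m.+1 else leaf.

(* R n is meant for n >= 1, and then has n leaves. *)
Definition R n : tree n.-1.+1 := right_vine n.-1.

Record cactus_pair := CactusPair {
  pair_size : nat;
  pair_top : tree pair_size;
  pair_elt : J pair_size;
  pair_bot : tree pair_size }.

Inductive expansion : cactus_pair -> cactus_pair -> Prop :=
| Expansion n (A B : tree n) (s : J n) (w : seq (cactus_gen n)) (i : nat) :
    (1 <= i <= n)%N -> s = cactus_prod w ->
    expansion (CactusPair A s B)
      (CactusPair (attach A i) (word_expand w i) (attach B (word_pos w i))).

Definition cv_equiv : cactus_pair -> cactus_pair -> Prop :=
  Relation_Operators.clos_refl_sym_trans _ expansion.

Definition cv_equivb (x y : cactus_pair) : bool := `[< cv_equiv x y >].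

Lemma cv_equivb_refl : reflexive cv_equivb.
Proof. by move=> x; apply/asboolP/Relation_Operators.rst_refl. Qed.

Lemma cv_equivb_sym : symmetric cv_equivb.
Proof.
by move=> x y; apply/asboolP/asboolP => xy; apply: Relation_Operators.rst_sym.
Qed.

Lemma cv_equivb_trans : transitive cv_equivb.
Proof.
move=> y x z /asboolP xy /asboolP yz; apply/asboolP.
exact: Relation_Operators.rst_trans xy yz.
Qed.

HB.instance Definition _ := gen_eqMixin cactus_pair.
HB.instance Definition _ := gen_choiceMixin cactus_pair.

Canonical cv_equivb_equiv :=
  EquivRel cv_equivb cv_equivb_refl cv_equivb_sym cv_equivb_trans.

Definition CV := {eq_quot cv_equivb}.
HB.instance Definition _ := Choice.on CV.

Definition cv_class (x : cactus_pair) : CV := \pi x.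

(* The class of (A, s, B). *)
Definition cv n (A : tree n) (s : J n) (B : tree n) : CV :=
  cv_class (CactusPair A s B).

(* z is a product of x and y, for some choice of representatives. *)
Definition cv_prod (x y z : CV) : Prop :=
  exists n (A B C : tree n) (s t : J n),
    [/\ x = cv A s B, y = cv B t C & z = cv A (s * t) C].

Lemma cv_classP x y : cv_class x = cv_class y <-> cv_equiv x y.
Proof.
split=> [|xy]; last by apply/eqmodP/asboolP.
by move=> /eqmodP /asboolP.
Qed.

Lemma cv_class_surj (x : CV) : exists p, x = cv_class p.
Proof. by exists (repr x); rewrite /cv_class reprK. Qed.

Fixpoint tle (A D : btree) : bool :=
  match A, D with
  | Leaf, _ => true
  | Node a b, Node c d => tle a c && tle b d
  | Node _ _, Leaf => false
  end.

Fixpoint tjoin (A B : btree) : btree :=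
  match A, B with
  | Leaf, _ => B
  | _, Leaf => A
  | Node a b, Node c d => Node (tjoin a c) (tjoin b d)
  end.

Lemma tle_refl A : tle A A.
Proof. by elim: A => //= a -> b ->. Qed.

Lemma tle_trans B A C : tle A B -> tle B C -> tle A C.
Proof.
elim: A B C => // a IHa b IHb [|c d] [|e f] //= /andP[ac bd] /andP[ce df].
by apply/andP; split; [apply: IHa ac ce|apply: IHb bd df].
Qed.

Lemma tle_joinl A B : tle A (tjoin A B).
Proof.
elim: A B => // a IHa b IHb [|c d] /=; first by rewrite !tle_refl.
by rewrite IHa IHb.
Qed.

Lemma tle_joinr A B : tle B (tjoin A B).
Proof.
elim: A B => [|a IHa b IHb [|c d]] //=; first exact: tle_refl.
by rewrite IHa IHb.
Qed.

Lemma leaves_gt0 A : (0 < leaves A)%N.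
Proof. by elim: A => //= a Ha b Hb; rewrite addn_gt0 Ha. Qed.

Lemma tle_attach A i : tle A (attach_caret A i).
Proof.
by elim: A i => //= a IHa b IHb i; case: ifP => _ /=; rewrite ?IHa ?IHb tle_refl.
Qed.

Lemma tle_leaves A D : tle A D -> (leaves A <= leaves D)%N.
Proof.
elim: A D => [|a IHa b IHb] [|c d] //=; first by rewrite addn_gt0 leaves_gt0.
by case/andP=> /IHa ac /IHb bd; apply: leq_add.
Qed.

Lemma tle_eq A D : tle A D -> leaves A = leaves D -> A = D.
Proof.
elim: A D => [|a IHa b IHb] [|c d] //=.
  by have := leaves_gt0 c; have := leaves_gt0 d; lia.
case/andP=> ac bd; have := tle_leaves ac; have := tle_leaves bd => h1 h2 e.
by congr Node; [apply: IHa|apply: IHb] => //; lia.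
Qed.

Lemma tle_step A D : tle A D -> A <> D ->
  exists2 i, (0 < i <= leaves A)%N & tle (attach_caret A i) D.
Proof.
elim: A D => [|a IHa b IHb] [|c d] //=; first by move=> _ _; exists 1%N.
case/andP=> ac bd ne; have [e|ac'] := EM (a = c).
  have [|i Hi Hid] := IHb d bd; first by move=> f; apply: ne; rewrite e f.
  exists (leaves a + i)%N; first lia.
  by rewrite ifF ?addKn /= ?ac //; lia.
have [i Hi Hid] := IHa c ac ac'.
exists i; first lia.
by rewrite ifT /= ?Hid //; lia.
Qed.

Lemma tle_attach2 A D p q : (0 < p <= leaves A)%N -> (0 < q <= leaves A)%N ->
  p <> q -> tle (attach_caret A p) D -> tle (attach_caret A q) D ->
  tle (attach_caret (attach_caret A p) (shift p q)) D.
Proof.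
elim: A D p q => [|a IHa b IHb] D p q /=; first by lia.
move=> pn qn pq; case: leqP => pa; case: leqP => qa; case: D => // c d /=.
- case/andP=> ap bd /andP[aq _]; rewrite leaves_attach ifT /=.
    by rewrite IHa //; lia.
  by rewrite /shift; case: ifP; lia.
- case/andP=> ap _ /andP[_ bq]; rewrite leaves_attach shift_lt; last lia.
  by rewrite ifF /= ?subSS ?ap //; lia.
- case/andP=> _ bp /andP[aq _]; rewrite shift_ge; last lia.
  by rewrite ifT /= ?aq //; lia.
case/andP=> ac bp /andP[_ bq]; rewrite ifF /=; last first.
  by rewrite /shift; case: ifP; lia.
rewrite ac (_ : shift p q - leaves a = shift (p - leaves a) (q - leaves a))%N.
  by rewrite IHb //; lia.
have [lt|lt] : (p < q)%N \/ (q < p)%N by lia.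
  by rewrite !shift_lt; lia.
by rewrite !shift_ge; lia.
Qed.

Lemma attach_comm A p q : (0 < p <= leaves A)%N -> (0 < q <= leaves A)%N ->
  p <> q -> attach_caret (attach_caret A p) (shift p q) =
            attach_caret (attach_caret A q) (shift q p).
Proof.
move=> pn qn pq; apply: tle_eq; last by rewrite !leaves_attach.
apply: tle_attach2 => //; last exact: tle_attach.
set D := attach_caret (attach_caret A q) _.
have : forall A p q, (0 < p <= leaves A)%N -> (0 < q <= leaves A)%N -> p <> q ->
   tle (attach_caret A p) (attach_caret (attach_caret A q) (shift q p)).
  move=> {}A {D pn qn pq}; elim: A {p q} => [|a IHa b IHb] p q /=; first by lia.
  move=> pn qn pq; have [pa|pa] := leqP p (leaves a);
    have [qa|qa] := leqP q (leaves a) => /=.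
  - rewrite leaves_attach ifT /= ?IHa ?tle_refl //; try lia.
    by rewrite /shift; case: ifP; lia.
  - by rewrite shift_ge ?ifT /= ?tle_refl ?tle_attach //; lia.
  - rewrite leaves_attach shift_lt ?ifF /= ?subSS ?tle_refl ?tle_attach //; lia.
  rewrite ifF /= ?tle_refl /=; last by rewrite /shift; case: ifP; lia.
  rewrite (_ : shift q p - leaves a = shift (q - leaves a) (p - leaves a))%N.
    by apply: IHb; lia.
  have [lt|lt] : (q < p)%N \/ (p < q)%N by lia.
    by rewrite !shift_lt; lia.
  by rewrite !shift_ge; lia.
exact.
Qed.

Definition expand1 (x : cactus_pair) (i : nat) : cactus_pair :=
  CactusPair (attach (pair_top x) i) (Jexpand (pair_elt x) i)
    (attach (pair_bot x) (Jpos (pair_elt x) i)).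

Inductive expands : cactus_pair -> cactus_pair -> Prop :=
| expands0 x : expands x x
| expandsS x i y : (0 < i <= pair_size x)%N -> expands (expand1 x i) y ->
    expands x y.

Lemma expansionP x y : expansion x y <->
  exists2 i, (0 < i <= pair_size x)%N & y = expand1 x i.
Proof.
split=> [[n A B s w i Hi ->]|[i Hi ->]].
  by exists i => //; rewrite /expand1 /= Jexpand_prod Jpos_prod.
case: x Hi => n A s B /= Hi; have [w ws] := cactus_prod_surj s.
rewrite /expand1 /=; have := @Expansion n A B s w i Hi ws.
by rewrite {1 2 3 4}ws Jexpand_prod Jpos_prod.
Qed.

Lemma expands_trans x y z : expands x y -> expands y z -> expands x z.
Proof. by elim=> // {x y} x i y Hi _ IH /IH; apply: expandsS. Qed.

Lemma expands_equiv x y : expands x y -> cv_equiv x y.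
Proof.
elim=> {x y} [x|x i y Hi _ IH]; first exact: Relation_Operators.rst_refl.
apply: Relation_Operators.rst_trans IH.
by apply/Relation_Operators.rst_step/expansionP; exists i.
Qed.

Lemma expand1_comm x p q :
  (0 < p <= pair_size x)%N -> (0 < q <= pair_size x)%N -> p <> q ->
  expand1 (expand1 x p) (shift p q) = expand1 (expand1 x q) (shift q p).
Proof.
case: x => n A s B /= pn qn pq; rewrite /expand1 /=; congr CactusPair.
- by apply: tree_inj; rewrite /= attach_comm // leaves_tree.
- exact: Jexpand_shift.
have qp : q <> p by move/esym.
apply: tree_inj; rewrite /= !Jpos_shift // attach_comm // ?leaves_tree.
- exact: Jpos_bound.
- exact: Jpos_bound.
by move/Jpos_inj.
Qed.

Lemma expands_top x y : expands x y -> tle (pair_top x) (pair_top y).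
Proof.
elim=> {x y} [x|x i y _ _]; first exact: tle_refl.
by apply: tle_trans; apply: tle_attach.
Qed.

Lemma expands_bot x y : expands x y -> tle (pair_bot x) (pair_bot y).
Proof.
elim=> {x y} [x|x i y _ _]; first exact: tle_refl.
by apply: tle_trans; apply: tle_attach.
Qed.

Lemma expands_to x (D : btree) : tle (pair_top x) D ->
  exists2 y, expands x y & pair_top y = D :> btree.
Proof.
have [k] := ubnP (leaves D - pair_size x)%N; elim: k x => // k IHk x lt xD.
have [e|ne] := EM (pair_top x = D :> btree).
  by exists x => //; apply: expands0.
have [i Hi Hid] := tle_step xD ne.
have [|//|y xy yD] := IHk (expand1 x i).
  by have := tle_leaves Hid; rewrite leaves_attach leaves_tree /=; lia.
exists y => //; apply: expandsS xy; by rewrite leaves_tree in Hi.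
Qed.

Lemma expands_eq x y : expands x y -> pair_top x = pair_top y :> btree -> x = y.
Proof.
case=> // {}x i {}y Hi /expands_top/tle_leaves /= + e.
by rewrite -e leaves_attach; lia.
Qed.

Lemma expandsP x y : expands x y ->
  x = y \/ exists2 i, (0 < i <= pair_size x)%N & expands (expand1 x i) y.
Proof. by case=> [{}x|{}x i {}y Hi iy]; [left|right; exists i]. Qed.

Lemma expands_uniq x y z : expands x y -> expands x z ->
  pair_top y = pair_top z :> btree -> y = z.
Proof.
have [k] := ubnP (leaves (pair_top y) - pair_size x)%N.
elim: k x y z => // k IHk x y z lt xy xz yz.
case: (expandsP xy) => [e|[i Hi iy]].
  by rewrite -e in yz *; apply: expands_eq.
case: (expandsP xz) => [e|[j Hj jz]].
  by rewrite -e in yz *; apply/esym/expands_eq.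
have ti := expands_top iy; have tj := expands_top jz; rewrite -yz in tj.
have lk : (leaves (pair_top y) - (pair_size x).+1 < k)%N.
  by have := tle_leaves ti; rewrite /= leaves_attach leaves_tree; lia.
have [e|ij] := eqVneq i j; first by rewrite -e in jz; apply: (IHk (expand1 x i)).
move/eqP in ij; have ji : j <> i by move/esym.
have [|w cw wD] := @expands_to (expand1 (expand1 x i) (shift i j)) (pair_top y).
  by apply: tle_attach2; rewrite ?leaves_tree.
have rij : (0 < shift i j <= (pair_size x).+1)%N by rewrite /shift; case: ifP; lia.
have rji : (0 < shift j i <= (pair_size x).+1)%N by rewrite /shift; case: ifP; lia.
have yw : y = w.
  by apply: (IHk (expand1 x i)) => //; apply: expandsS cw.
have zw : z = w.
  rewrite (expand1_comm Hi Hj ij) in cw.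
  by apply: (IHk (expand1 x j)); rewrite -?yz //; apply: expandsS cw.
by rewrite yw zw.
Qed.

Lemma expands_join x y z : expands x y -> expands x z ->
  exists2 w, expands y w & expands z w.
Proof.
move=> xy xz; set D := tjoin (pair_top y) (pair_top z).
have [v yv vD] := expands_to (tle_joinl (pair_top y) (pair_top z)).
have [w zw wD] := expands_to (tle_joinr (pair_top y) (pair_top z)).
exists v => //; rewrite (_ : v = w) //.
apply: (expands_uniq (expands_trans xy yv) (expands_trans xz zw)).
by rewrite vD wD.
Qed.

Lemma equiv_expands x y : cv_equiv x y -> exists2 z, expands x z & expands y z.
Proof.
elim=> {x y} [x y /expansionP[i Hi ->]|x|x y _ [z xz yz]|x y z _ [u xu yu] _ [v yv zv]].
- exists (expand1 x i); last exact: expands0.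
  exact: expandsS (expands0 _).
- by exists x; apply: expands0.
- by exists z.
have [w uw vw] := expands_join yu yv; exists w; first exact: expands_trans uw.
exact: expands_trans vw.
Qed.

Definition pair_inv (x : cactus_pair) : cactus_pair :=
  CactusPair (pair_bot x) (pair_elt x)^-1 (pair_top x).

Lemma pair_invK : involutive pair_inv.
Proof. by case=> n A s B; rewrite /pair_inv /= invgK. Qed.

Lemma pair_inv_expand1 x i :
  pair_inv (expand1 x i) = expand1 (pair_inv x) (Jpos (pair_elt x) i).
Proof. by rewrite /pair_inv /expand1 /= JexpandV JposK. Qed.

Lemma expands_inv x y : expands x y -> expands (pair_inv x) (pair_inv y).
Proof.
elim=> {x y} [x|x i y Hi _ IH]; first exact: expands0.
rewrite pair_inv_expand1 in IH; apply: expandsS IH.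
by rewrite /= Jpos_bound.
Qed.

Lemma expands_to_bot x (D : btree) : tle (pair_bot x) D ->
  exists2 y, expands x y & pair_bot y = D :> btree.
Proof.
move=> h; have [y /expands_inv] := @expands_to (pair_inv x) D h.
by rewrite pair_invK => xy yD; exists (pair_inv y).
Qed.

Lemma expands_uniq_bot x y z : expands x y -> expands x z ->
  pair_bot y = pair_bot z :> btree -> y = z.
Proof.
move=> /expands_inv xy /expands_inv xz e; apply: (can_inj pair_invK).
exact: expands_uniq xy xz e.
Qed.

Definition pair_prod (x y z : cactus_pair) : Prop :=
  exists n (A B C : tree n) (s t : J n),
    [/\ x = CactusPair A s B, y = CactusPair B t C &
        z = CactusPair A (s * t) C].

Lemma CactusPair_inj n (A A' B B' : tree n) (s s' : J n) :
  CactusPair A s B = CactusPair A' s' B' -> [/\ A = A', s = s' & B = B'].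
Proof.
by case=> h1 h2 h3; split;
  apply: (Eqdep_dec.inj_pair2_eq_dec _ PeanoNat.Nat.eq_dec).
Qed.

Lemma pair_prod_fun x y z z' : pair_prod x y z -> pair_prod x y z' -> z = z'.
Proof.
move=> [n [A [B [C [s [t [-> -> ->]]]]]]] [m [A' [B' [C' [s' [t' [e1 e2 ->]]]]]]].
have nm : n = m := congr1 pair_size e1.
move: A' B' C' s' t' e1 e2; case: m / nm => A' B' C' s' t'.
by move=> /CactusPair_inj[-> -> _] /CactusPair_inj[_ -> ->].
Qed.

Lemma pair_prod_ex x y : pair_bot x = pair_top y :> btree ->
  exists z, pair_prod x y z.
Proof.
case: x y => n A s B [m B' t C] /= e.
have nm : n = m by rewrite -(leaves_tree B) e leaves_tree.
move: B' t C e; case: m / nm => B' t C /tree_inj <-.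
by eexists; exists n, A, B, C, s, t.
Qed.

Lemma pair_prod_expands x x' y y' z : pair_prod x y z ->
  expands x x' -> expands y y' -> pair_bot x' = pair_top y' :> btree ->
  exists2 z', expands z z' & pair_prod x' y' z'.
Proof.
move=> + xx'; elim: xx' y z => {x x'} [x|x i x' Hi xx' IH] y z xyz yy' e.
  exists z; first exact: expands0.
  rewrite -(expands_eq yy') // -e.
  by case: xyz => [n [A [B [C [s [t [-> -> _]]]]]]].
case: xyz Hi xx' IH => [n [A [B [C [s [t [xE yE zE]]]]]]] Hi xx' IH.
pose j := Jpos s i.
have xyz1 : pair_prod (expand1 x i) (expand1 y j) (expand1 z i).
  rewrite xE yE zE /expand1 /= JexpandM JposM.
  by exists n.+1; do 5 eexists; split; reflexivity.
have Hj : (0 < j <= pair_size y)%N.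
  by rewrite yE /= Jpos_bound //; move: Hi; rewrite xE.
have [|y'' yy'' e''] := @expands_to (expand1 y j) (pair_top y').
  by rewrite -e; have := expands_bot xx'; rewrite xE yE.
have y'E : y'' = y' by apply: expands_uniq e''; [apply: expandsS yy''|].
rewrite y'E in yy''; have [z' zz' p] := IH _ _ xyz1 yy'' e.
exists z' => //; apply: expandsS zz'.
by move: Hi; rewrite xE zE.
Qed.

(* x and y have expansions x' and y' with product z *)
Definition wprod x y z :=
  exists x' y', [/\ expands x x', expands y y' & pair_prod x' y' z].

Lemma wprod_ex x y : exists z, wprod x y z.
Proof.
have [x' xx' ex] := expands_to_bot (tle_joinl (pair_bot x) (pair_top y)).
have [y' yy' ey] := expands_to (tle_joinr (pair_bot x) (pair_top y)).
have [|z p] := @pair_prod_ex x' y'; first by rewrite ex ey.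
by exists z, x', y'.
Qed.

Lemma wprod_uniq x y z z' : wprod x y z -> wprod x y z' -> cv_equiv z z'.
Proof.
move=> [x1 [y1 [xx1 yy1 p1]]] [x2 [y2 [xx2 yy2 p2]]].
have [z3 [x3 [y3 [xx3 yy3 p3]]]] := wprod_ex x y.
have key x1' y1' z1 : expands x x1' -> expands y y1' -> pair_prod x1' y1' z1 ->
    forall x2' y2' z2, expands x x2' -> expands y y2' -> pair_prod x2' y2' z2 ->
    cv_equiv z1 z2.
  move=> a1 b1 q1 x2' y2' z2 a2 b2 q2.
  have bt u v w : pair_prod u v w -> pair_bot u = pair_top v :> btree.
    by case=> [n [A [B [C [s [t [-> -> _]]]]]]].
  pose D := tjoin (pair_bot x1') (pair_bot x2').
  have [xa xa1 xaD] := expands_to_bot (tle_joinl (pair_bot x1') (pair_bot x2')).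
  have [xb xb2 xbD] := expands_to_bot (tle_joinr (pair_bot x1') (pair_bot x2')).
  have [|ya ya1 yaD] := @expands_to y1' D; first by rewrite -(bt _ _ _ q1) tle_joinl.
  have [|yb yb2 ybD] := @expands_to y2' D; first by rewrite -(bt _ _ _ q2) tle_joinr.
  have xab : xa = xb.
    apply: (expands_uniq_bot (expands_trans a1 xa1) (expands_trans a2 xb2)).
    by rewrite xaD xbD.
  have yab : ya = yb.
    apply: (expands_uniq (expands_trans b1 ya1) (expands_trans b2 yb2)).
    by rewrite yaD ybD.
  have [|za z1a pa] := pair_prod_expands q1 xa1 ya1; first by rewrite xaD yaD.
  have [|zb z2b pb] := pair_prod_expands q2 xb2 yb2; first by rewrite xbD ybD.
  rewrite -xab -yab in pb; rewrite -(pair_prod_fun pa pb) in z2b.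
  apply: Relation_Operators.rst_trans (expands_equiv z1a) _.
  exact/Relation_Operators.rst_sym/expands_equiv.
exact: key xx1 yy1 p1 _ _ _ xx2 yy2 p2.
Qed.

Lemma wprod_expands x x1 y y1 z : expands x x1 -> expands y y1 ->
  wprod x1 y1 z -> wprod x y z.
Proof.
move=> xx1 yy1 [x' [y' [a b p]]]; exists x', y'; split=> //.
  exact: expands_trans xx1 a.
exact: expands_trans yy1 b.
Qed.

Lemma wprod_equiv x x1 y y1 z z1 : cv_equiv x x1 -> cv_equiv y y1 ->
  wprod x y z -> wprod x1 y1 z1 -> cv_equiv z z1.
Proof.
move=> /equiv_expands[x' xx' x1x'] /equiv_expands[y' yy' y1y'] p p1.
have [z' p'] := wprod_ex x' y'.
apply: Relation_Operators.rst_trans (wprod_uniq p (wprod_expands xx' yy' p')) _.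
exact: wprod_uniq (wprod_expands x1x' y1y' p') p1.
Qed.

Lemma pair_prod_wprod x y z : pair_prod x y z -> wprod x y z.
Proof. by exists x, y; split=> //; apply: expands0. Qed.

Lemma cv_expands x y : expands x y -> cv_class x = cv_class y.
Proof. by move=> /expands_equiv/cv_classP. Qed.

Lemma cv_prod_ex (x y : CV) : exists z, cv_prod x y z.
Proof.
have [p ->] := cv_class_surj x; have [q ->] := cv_class_surj y.
have [z [p' [q' [pp' qq' [n [A [B [C [s [t [pE qE zE]]]]]]]]]]] := wprod_ex p q.
exists (cv A (s * t) C); exists n, A, B, C, s, t; split=> //.
  by rewrite (cv_expands pp') pE.
by rewrite (cv_expands qq') qE.
Qed.

Lemma cv_prod_fun (x y z z' : CV) : cv_prod x y z -> cv_prod x y z' -> z = z'.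
Proof.
move=> [n [A [B [C [s [t [-> -> ->]]]]]]] [m [A' [B' [C' [s' [t' [e1 e2 ->]]]]]]].
apply/cv_classP; move/cv_classP: e1 => e1; move/cv_classP: e2 => e2.
apply: (wprod_equiv e1 e2); apply: pair_prod_wprod.
  by exists n, A, B, C, s, t.
by exists m, A', B', C', s', t'.
Qed.

Definition cv_mul (x y : CV) : CV := projT1 (cid (cv_prod_ex x y)).

Lemma cv_mulP x y z : cv_prod x y z <-> z = cv_mul x y.
Proof.
have H : cv_prod x y (cv_mul x y) by rewrite /cv_mul; case: cid.
by split=> [h|-> //]; apply: cv_prod_fun h H.
Qed.

Lemma cv_mulE n (A B C : tree n) (s t : J n) :
  cv_mul (cv A s B) (cv B t C) = cv A (s * t) C.
Proof. by apply/esym/cv_mulP; exists n, A, B, C, s, t. Qed.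

Definition cv_one : CV := cv leaf 1 leaf.

Definition cv_inv (x : CV) : CV := cv_class (pair_inv (repr x)).

Lemma cv_invE n (A B : tree n) (s : J n) : cv_inv (cv A s B) = cv B s^-1 A.
Proof.
apply/cv_classP; have : cv_equiv (repr (cv A s B)) (CactusPair A s B).
  by apply/cv_classP; rewrite /cv_class reprK.
case/equiv_expands=> z /expands_inv/expands_equiv h1 /expands_inv/expands_equiv h2.
exact: Relation_Operators.rst_trans h1 (Relation_Operators.rst_sym _ _ _ _ h2).
Qed.

Lemma cv_oneE n (T : tree n) : cv T 1 T = cv_one.
Proof.
have [x lx xT] := @expands_to (CactusPair leaf 1 leaf) T isT.
rewrite /cv_one /cv (cv_expands lx); congr cv_class.
have [-> _] : x = CactusPair (pair_top x) 1 (pair_top x) /\ True.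
  split=> //; have : exists n (U : tree n), CactusPair leaf 1 leaf = CactusPair U 1 U.
    by exists 1%N, leaf.
  elim: lx {xT} => {x} [x [m [U ->]] //|x i y Hi _ IH [m [U xE]]].
  apply: IH; exists m.+1, (attach U i).
  by rewrite xE /expand1 /= Jexpand1 Jpos1.
have nx : n = pair_size x by rewrite -(leaves_tree T) -xT leaves_tree.
move: (pair_top x) xT; case: _ / nx => U /tree_inj ->.
by [].
Qed.

Lemma cv_surj (x : CV) : exists n (A B : tree n) (s : J n), x = cv A s B.
Proof. by have [[n A s B] ->] := cv_class_surj x; exists n, A, B, s. Qed.

Lemma cv_mul1 : left_id cv_one cv_mul.
Proof. by move=> x; have [n [A [B [s ->]]]] := cv_surj x; rewrite -(cv_oneE A) cv_mulE mul1g. Qed.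

Lemma cv_mulr1 : right_id cv_one cv_mul.
Proof. by move=> x; have [n [A [B [s ->]]]] := cv_surj x; rewrite -(cv_oneE B) cv_mulE mulg1. Qed.

Lemma cv_mulV : left_inverse cv_one cv_inv cv_mul.
Proof.
by move=> x; have [n [A [B [s ->]]]] := cv_surj x; rewrite cv_invE cv_mulE mulVg cv_oneE.
Qed.

Lemma cv_mulrV : right_inverse cv_one cv_inv cv_mul.
Proof.
by move=> x; have [n [A [B [s ->]]]] := cv_surj x; rewrite cv_invE cv_mulE mulgV cv_oneE.
Qed.

Lemma cv_mulA : associative cv_mul.
Proof.
move=> x y z; have [p ->] := cv_class_surj x; have [q ->] := cv_class_surj y.
have [r ->] := cv_class_surj z.
have [q1 qq1 e1] := expands_to_bot (tle_joinl (pair_bot q) (pair_top r)).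
have [r1 rr1 e1'] := expands_to (tle_joinr (pair_bot q) (pair_top r)).
have [p2 pp2 e2] := expands_to_bot (tle_joinl (pair_bot p) (pair_top q1)).
have [q2 q12 e2'] := expands_to (tle_joinr (pair_bot p) (pair_top q1)).
have [|r2 r12 e3] := @expands_to r1 (pair_bot q2).
  by rewrite e1' -e1; apply: expands_bot.
rewrite (cv_expands pp2) (cv_expands (expands_trans qq1 q12)).
rewrite (cv_expands (expands_trans rr1 r12)).
have {}e2 : pair_bot p2 = pair_top q2 :> btree by rewrite e2 e2'.
case: p2 q2 r2 e2 e3 {pp2 q12 r12 e2'} => n A s B [m B' t C] [k C' u D] /= e2 e3.
have nm : n = m by rewrite -(leaves_tree B) e2 leaves_tree.
have mk : m = k by rewrite -(leaves_tree C) -e3 leaves_tree.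
case: m / nm mk B' t C e2 e3 => nk B' t C e2 e3.
case: k / nk C' u D e3 => C' u D e3.
rewrite -(tree_inj e2) (tree_inj e3) -!/(cv _ _ _) !cv_mulE.
by rewrite mulgA.
Qed.

HB.instance Definition _ :=
  isGroup.Build CV cv_mulA cv_mul1 cv_mulr1 cv_mulV cv_mulrV.

Lemma cvM n (A B C : tree n) (s t : J n) :
  cv A s B * cv B t C = cv A (s * t) C.
Proof. exact: cv_mulE. Qed.

Lemma cvV n (A B : tree n) (s : J n) : (cv A s B)^-1 = cv B s^-1 A.
Proof. exact: cv_invE. Qed.

Lemma cv1 n (T : tree n) : cv T 1 T = 1.
Proof. exact: cv_oneE. Qed.

Definition index_pair := {p : nat * nat | (1 <= p.1 < p.2)%N}.

Inductive cv_gen :=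
| GenX of nat
| GenSigma of index_pair
| GenTau of index_pair.

HB.instance Definition _ := gen_eqMixin cv_gen.
HB.instance Definition _ := gen_choiceMixin cv_gen.

Definition x_elt (i : nat) : CV :=
  cv (attach (R i.+2) i.+1) 1 (R i.+3).

Definition sigma_elt (i j : nat) : CV :=
  cv (R j.+1) (cs j.+1 i j) (R j.+1).

(* For 1 <= i < j the index j.-1.+1, imposed by the type of [R j], is j. *)
Definition tau_elt (i j : nat) : CV :=
  cv (R j) (cs j.-1.+1 i j) (R j).

Definition cv_gen_elt (g : cv_gen) : CV :=
  match g with
  | GenX i => x_elt i
  | GenSigma a => sigma_elt (val a).1 (val a).2
  | GenTau a => tau_elt (val a).1 (val a).2
  end.

Module CVLetters.

Definition x (i : nat) : word cv_gen := [:: (GenX i, true)].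

(* As with [cactus_letter], the value [::] is junk: the indices of all the
   letters in the relations below are in range. *)
Definition sigma (i j : nat) : word cv_gen :=
  if insub (i, j) is Some a then [:: (GenSigma a, true)] else [::].

Definition tau (i j : nat) : word cv_gen :=
  if insub (i, j) is Some a then [:: (GenTau a, true)] else [::].

(* x_a x_{a+1} ... x_{b-1} *)
Definition xs (a b : nat) : word cv_gen := flatten [seq x m | m <- index_iota a b].

End CVLetters.

Section CVRelations.
Import CVLetters.
Local Open Scope nat_scope.

(* All the truncated subtractions below are exact under the side conditions. *)
Inductive cv_rel : word cv_gen -> word cv_gen -> Prop :=
| cv_relA i j : i < j ->
    cv_rel (x j ++ x i) (x i ++ x (j + 1))
| cv_relB1_sigma i j : 1 <= i < j ->
    cv_rel (sigma i j ++ sigma i j) [::]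
| cv_relB1_tau i j : 1 <= i < j ->
    cv_rel (tau i j ++ tau i j) [::]
| cv_relB2 i j k l : 1 <= i < j -> j < k < l ->
    cv_rel (sigma i j ++ sigma k l) (sigma k l ++ sigma i j)
| cv_relB3 i j k l : 1 <= i <= k -> k < l <= j ->
    cv_rel (sigma i j ++ sigma k l) (sigma (i + j - l) (i + j - k) ++ sigma i j)
| cv_relB4 i j k : 1 <= i < k -> k < j ->
    cv_rel (tau i j ++ tau k j) (sigma i (i + j - k) ++ tau i j)
| cv_relB5 i j k l : 1 <= i < j -> j < k < l ->
    cv_rel (sigma i j ++ tau k l) (tau k l ++ sigma i j)
| cv_relB6 i j l : 1 <= i < l -> l < j ->
    cv_rel (tau i j ++ sigma i l) (tau (i + j - l) j ++ tau i j)
| cv_relB7 i j k l : 1 <= i < k -> k < l < j ->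
    cv_rel (tau i j ++ sigma k l) (sigma (i + j - l) (i + j - k) ++ tau i j)
| cv_relC1 i j k : 1 <= i < j -> j <= k ->
    cv_rel (sigma i j ++ x k) (x k ++ sigma i j)
| cv_relC2 i j k : 1 <= i < j -> i - 1 <= k <= j - 1 ->
    cv_rel (sigma i j ++ x k)
           (x (i + j - k - 2) ++ sigma i (j + 1) ++ sigma (k + 1) (k + 2))
| cv_relC3 i j k : 2 <= i < j -> k <= i - 2 ->
    cv_rel (sigma i j ++ x k) (x k ++ sigma (i + 1) (j + 1))
| cv_relD1 i j k : 1 <= i < j -> j - 1 < k ->
    cv_rel (tau i j ++ x k)
           (xs (i - 1) (k - j + i) ++ x (k - j + i) ++ x (k - j + i) ++
            tau i (k + 3) ++ tau j (k + 3))
| cv_relD2 i j : 1 <= i < j ->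
    cv_rel (tau i j ++ x (j - 1))
           (x (i - 1) ++ x (i - 1) ++ tau i (j + 2) ++ tau j (j + 2))
| cv_relD3 i j k : 1 <= i < j -> i <= k <= j - 2 ->
    cv_rel (tau i j ++ x k)
           (x (i + j - k - 2) ++ tau i (j + 1) ++ sigma (k + 1) (k + 2))
| cv_relD4 i j : 1 <= i < j ->
    cv_rel (tau i j ++ x (i - 1)) (tau i (j + 1) ++ sigma i (i + 1))
| cv_relD5 i j k : 2 <= i < j -> k <= i - 2 ->
    cv_rel (tau i j ++ x k) (x k ++ tau (i + 1) (j + 1)).

End CVRelations.

(* Main.v *)
From HB Require Import structures.
Require Import Defs.
From mathcomp Require Import all_boot zify boolp.

Set Implicit Arguments.
Unset Strict Implicit.
Unset Printing Implicit Defensive.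

Local Open Scope nat_scope.
Local Open Scope group_scope.

(** Write V_n for the right vine with n leaves.  Everything rests on two
    families of elements of CV: the homomorphic images (V_n, s, V_n) of the
    cactus groups, and the carets (V_n with a caret at leaf p, 1, V_(n+1)),
    which are x_(p-1) for p < n and trivial for p = n.  Expanding (V_n, s, V_n)
    at leaf p gives the exchange rule

      s * caret_n (s p) = caret_n p * s^(p),

    where s^(p) in J_(n+1) is the expansion of s at p ([vine_exchange]).  For
    s = s_{i,j}, which is sigma_{i,j} when j < n and tau_{i,j} when j = n, this
    rule, the cactus relations and the commutation of carets at distinct leaves
    are the relations (A), (B), (C), (D3), (D4), (D5).  The remaining (D1) and
    (D2) follow from those: unfolding tau_{i,j} along the vine as
    x_(i-1) ... x_(i+m-1) sigma_{i,i+m+1} tau_{i,j+m+1} reduces both of them to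
    (D3) ([tau_unfold_iter], [tau_x_right]).  So the presented group P maps
    to CV.

    The inverse sends (A, s, B) to w(A) * r(s) * w(B)^-1.  The homomorphism
    r : J_n -> P sends s_{i,j} to the letter sigma or tau as above, and exists
    because of (B) ([cactus_rel_holds]).  The word w(A) in the x_i builds A
    caret by caret, so that w of A with a caret at leaf i is
    w(A) * caret_n i ([treeP_attach], by (A)).  The formula is invariant under
    expansion exactly when r satisfies the exchange rule in P
    ([JP_exchange]); multiplicativity reduces this to s = s_{i,j}, where it
    is (C1)-(C3) and (D3)-(D5).  The two maps are homomorphisms, inverse to each
    other on the generators of P; on the other side every cactus-tree pair
    factors as (A, 1, V_n) (V_n, s, V_n) (V_n, 1, B). *)

(** * Homomorphisms out of a presented group *)

Section UniversalProperty.
Variables (X : choiceType) (R : word X -> word X -> Prop) (G : groupType).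

Definition word_eval (f : X -> G) (u : word X) : G :=
  \prod_(a <- u) (if a.2 then f a.1 else (f a.1)^-1).

Lemma word_eval_cat f u v :
  word_eval f (u ++ v) = word_eval f u * word_eval f v.
Proof. exact: big_cat. Qed.

Lemma word_eval_gen f x : word_eval f [:: (x, true)] = f x.
Proof. exact: big_seq1. Qed.

Lemma word_eval_nil f : word_eval f [::] = 1.
Proof. exact: big_nil. Qed.

Section Lift.
Variable f : X -> G.
Hypothesis fR : forall u v, R u v -> word_eval f u = word_eval f v.

Lemma word_eval_eq u v : word_eq R u v -> word_eval f u = word_eval f v.
Proof.
elim=> {u v} [u//|u v _ -> //|u v w _ -> _ -> //|u a b v|u l r v /fR lr].
  rewrite !word_eval_cat (_ : word_eval f [:: (a, b); (a, ~~ b)] = 1) ?mul1g //.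
  by rewrite /word_eval big_cons big_seq1; case: b; rewrite /= ?mulgV ?mulVg.
by rewrite !word_eval_cat lr.
Qed.

Definition presented_lift (g : presented R) : G := word_eval f (repr g).

Lemma presented_lift_word u : presented_lift (pword R u) = word_eval f u.
Proof. exact/word_eval_eq/repr_pword. Qed.

Lemma presented_lift_gen x : presented_lift (pgen R x) = f x.
Proof. by rewrite presented_lift_word word_eval_gen. Qed.

Lemma presented_liftM : {morph presented_lift : g h / g * h}.
Proof.
move=> g h; have [u ->] := pword_surj g; have [v ->] := pword_surj h.
by rewrite -pword_cat !presented_lift_word word_eval_cat.
Qed.

Lemma presented_lift1 : presented_lift 1 = 1.
Proof. by rewrite presented_lift_word word_eval_nil. Qed.

End Lift.

(** Two multiplicative maps between groups that agree on generators also agree on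
    inverses of generators, hence on all words. *)
Lemma presented_hom_eq (a b : presented R -> G) :
  {morph a : g h / g * h} -> {morph b : g h / g * h} ->
  (forall x, a (pgen R x) = b (pgen R x)) -> a =1 b.
Proof.
have hom1 (c : presented R -> G) : {morph c : g h / g * h} -> c 1 = 1.
  by move=> cM; apply: (@mulgI _ (c 1)); rewrite -cM !mulg1.
have homV (c : presented R -> G) : {morph c : g h / g * h} ->
    forall g, c g^-1 = (c g)^-1.
  by move=> cM g; apply: (@mulgI _ (c g)); rewrite -cM !mulgV hom1.
move=> aM bM ab g; have [u ->] := pword_surj g.
elim: u => [|[x e] u IHu]; first by rewrite (hom1 a) ?(hom1 b).
rewrite -cat1s pword_cat aM bM IHu; congr (_ * _).
by case: e; rewrite ?pgenV ?homV // ab.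
Qed.

End UniversalProperty.

(** * Vines in CV and the defining relations *)

Section Vines.
Implicit Types (m n i j k p q : nat).

Notation V := right_vine.

Definition vineJ m (s : J m.+1) : CV := cv (V m) s (V m).
Definition vineX m p : CV := cv (attach (V m) p) 1 (V m.+1).

Lemma vineJM m (s t : J m.+1) : vineJ (s * t) = vineJ s * vineJ t.
Proof. by rewrite /vineJ cvM. Qed.

Lemma vineJ1 m : vineJ (1 : J m.+1) = 1.
Proof. exact: cv1. Qed.

Lemma cv_expand1 n (A B : tree n) (s : J n) p : 0 < p <= n ->
  cv A s B = cv (attach A p) (Jexpand s p) (attach B (Jpos s p)).
Proof.
move=> pn; apply/cv_classP/expands_equiv.
exact: (@expandsS (CactusPair A s B) _ _ pn (expands0 _)).
Qed.

Lemma vineX_last m : vineX m m.+1 = 1.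
Proof. exact: cv1. Qed.

Lemma cv_vineX m (A : tree m.+1) p : 0 < p <= m.+1 ->
  cv A 1 (V m) * vineX m p = cv (attach A p) 1 (V m.+1).
Proof. by move=> pm; rewrite (cv_expand1 _ _ _ pm) Jexpand1 Jpos1 cvM mulg1. Qed.

(** Expanding at the last leaf lengthens the vine without changing the rest of
    the pair, which is why x_i does not depend on the number of leaves. *)
Lemma vineX_stable m p : 0 < p <= m -> vineX m p = vineX m.+1 p.
Proof.
move=> pm; rewrite /vineX (@cv_expand1 _ _ _ _ m.+2) ?Jexpand1 ?Jpos1 ?leqnn //.
congr (cv _ _ _); apply: tree_inj => /=.
have := @attach_comm (V m) p m.+1; rewrite shift_lt; last lia.
by rewrite shift_ge; [apply; rewrite ?leaves_tree; lia|lia].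
Qed.

Lemma x_vine m i : i < m -> x_elt i = vineX m i.+1.
Proof.
elim: m => // m IHm; rewrite ltnS leq_eqVlt => /orP[/eqP -> //|im].
by rewrite IHm // vineX_stable.
Qed.

(** Both sides are the expansion of (V, s, V) at leaf p, split once after and
    once before s. *)
Lemma vine_exchange m (s : J m.+1) p : 0 < p <= m.+1 ->
  vineJ s * vineX m (Jpos s p) = vineX m p * vineJ (Jexpand s p).
Proof.
move=> pm; rewrite /vineJ (@cv_expand1 _ (V m) _ _ p) // /vineX !cvM.
by rewrite mulg1 mul1g.
Qed.

Lemma vine_exchange_cs m i j p : 0 < i < j -> j <= m.+1 -> 0 < p <= m.+1 ->
  vineJ (cs m.+1 i j) * vineX m (gen_pos (i, j) p) =
  vineX m p * vineJ (gen_expand m.+1 (i, j) p).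
Proof.
move=> ij jm pm; have := vine_exchange (cs m.+1 i j) pm.
by rewrite Jpos_cs // Jexpand_cs.
Qed.

Lemma vine_exchange_gt m i j p : 0 < i < j -> j < p <= m.+1 ->
  vineJ (cs m.+1 i j) * vineX m p = vineX m p * vineJ (cs m.+2 i j).
Proof.
move=> ij jp; have := @vine_exchange_cs m i j p ij.
by rewrite gen_pos_out ?gen_expand_gt; [apply; lia|lia..].
Qed.

Lemma vine_exchange_lt m i j p : 0 < p < i -> i < j <= m.+1 ->
  vineJ (cs m.+1 i j) * vineX m p = vineX m p * vineJ (cs m.+2 i.+1 j.+1).
Proof.
move=> pi ij; have := @vine_exchange_cs m i j p.
by rewrite gen_pos_out ?gen_expand_lt; [apply; lia|lia..].
Qed.

(** The defining formula of the expansion yields s_{p,p+1} s_{i,j+1}; the nested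
    relation moves the short reversal to the right, as in (C2), (D3) and (D4).
    For j = m.+1, p = j the caret on the right-hand side is trivial. *)
Lemma vine_exchange_in m i j p q : 0 < i < j -> j <= m.+1 -> i <= p <= j ->
  p + q = i + j ->
  vineJ (cs m.+1 i j) * vineX m q =
  vineX m p * (vineJ (cs m.+2 i j.+1) * vineJ (cs m.+2 q q.+1)).
Proof.
move=> ij jm ip pq; rewrite -vineJM cs_nested; [|lia..].
have := @vine_exchange_cs m i j p ij jm.
rewrite gen_pos_in // gen_expand_in // (_ : i + j - p = q); last lia.
rewrite (_ : i + j.+1 - q.+1 = p); last lia.
by rewrite (_ : i + j.+1 - q = p.+1); [apply; lia|lia].
Qed.

(** A reversal that misses the last leaf survives the lengthening of the vine,
    so sigma_{i,j} is s_{i,j} on every vine with more than j leaves, whereas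
    tau_{i,j} is tied to the vine with exactly j leaves. *)
Lemma sigma_vine m i j : 0 < i < j -> j <= m ->
  sigma_elt i j = vineJ (cs m.+1 i j).
Proof.
move=> ij; elim: m => [|m IHm]; first lia.
rewrite leq_eqVlt => /orP[/eqP <- //|jm]; rewrite IHm //.
have := @vine_exchange_cs m i j m.+1 ij; rewrite gen_pos_out; last lia.
by rewrite gen_expand_gt // !vineX_last mulg1 mul1g; apply; rewrite ?leqnn //; lia.
Qed.

Lemma tau_vine m i : tau_elt i m.+1 = vineJ (cs m.+1 i m.+1).
Proof. by []. Qed.

Lemma x_x i j : i < j -> x_elt j * x_elt i = x_elt i * x_elt j.+1.
Proof.
move=> ij; rewrite (@x_vine j.+1 j) // {1}(@x_vine j.+2 i); last lia.
rewrite (@x_vine j.+1 i); last lia.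
rewrite (@x_vine j.+2 j.+1) // !cv_vineX; [|lia..].
congr (cv _ _ _); apply: tree_inj => /=.
have := @attach_comm (V j.+1) j.+1 i.+1; rewrite shift_ge; last lia.
by rewrite shift_lt; [apply; rewrite ?leaves_tree; lia|lia].
Qed.

Lemma sigma_sq i j : 0 < i < j -> sigma_elt i j * sigma_elt i j = 1.
Proof. by move=> ij; rewrite -vineJM csK vineJ1. Qed.

Lemma tau_sq i j : 0 < i < j -> tau_elt i j * tau_elt i j = 1.
Proof. by move=> ij; rewrite -vineJM csK vineJ1. Qed.

Lemma sigma_sigma_disjoint i j k l : 0 < i < j -> j < k < l ->
  sigma_elt i j * sigma_elt k l = sigma_elt k l * sigma_elt i j.
Proof.
move=> ij kl; rewrite !(@sigma_vine l); [|lia..].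
by rewrite -!vineJM cs_disjoint //; lia.
Qed.

Lemma sigma_sigma_nested i j k l : 0 < i <= k -> k < l <= j ->
  sigma_elt i j * sigma_elt k l =
  sigma_elt (i + j - l) (i + j - k) * sigma_elt i j.
Proof.
move=> ik kl; rewrite !(@sigma_vine j); [|lia..].
by rewrite -!vineJM cs_nested //; lia.
Qed.

Lemma tau_tau_nested i j k : 0 < i < k -> k < j ->
  tau_elt i j * tau_elt k j = sigma_elt i (i + j - k) * tau_elt i j.
Proof.
case: j => [|m] ik kj; first lia.
rewrite (@sigma_vine m) ?tau_vine; [|lia..].
by rewrite -!vineJM cs_nested ?addnK //; lia.
Qed.

Lemma sigma_tau_disjoint i j k l : 0 < i < j -> j < k < l ->
  sigma_elt i j * tau_elt k l = tau_elt k l * sigma_elt i j.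
Proof.
case: l => [|m] ij kl; first lia.
rewrite (@sigma_vine m) ?tau_vine; [|lia..].
by rewrite -!vineJM cs_disjoint //; lia.
Qed.

Lemma tau_sigma_left i j l : 0 < i < l -> l < j ->
  tau_elt i j * sigma_elt i l = tau_elt (i + j - l) j * tau_elt i j.
Proof.
case: j => [|m] il lj; first lia.
rewrite (@sigma_vine m) ?tau_vine; [|lia..].
by rewrite -!vineJM cs_nested ?addKn //; lia.
Qed.

Lemma tau_sigma_nested i j k l : 0 < i < k -> k < l < j ->
  tau_elt i j * sigma_elt k l =
  sigma_elt (i + j - l) (i + j - k) * tau_elt i j.
Proof.
case: j => [|m] ik kl; first lia.
rewrite !(@sigma_vine m) ?tau_vine; [|lia..].
by rewrite -!vineJM cs_nested //; lia.
Qed.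

Lemma sigma_x_right i j k : 0 < i < j -> j <= k ->
  sigma_elt i j * x_elt k = x_elt k * sigma_elt i j.
Proof.
move=> ij jk; rewrite {1}(@sigma_vine k.+1) ?(@sigma_vine k.+2 i j); [|lia..].
by rewrite (@x_vine k.+1) // vine_exchange_gt //; lia.
Qed.

Lemma sigma_x_in i j k : 0 < i < j -> i <= k.+1 <= j ->
  sigma_elt i j * x_elt k =
  x_elt (i + j - k - 2) * (sigma_elt i j.+1 * sigma_elt k.+1 k.+2).
Proof.
move=> ij ik; rewrite (@sigma_vine j) // !(@sigma_vine j.+1); [|lia..].
rewrite !(@x_vine j); [|lia..].
by apply: vine_exchange_in => //; lia.
Qed.

Lemma sigma_x_left i j k : k.+1 < i -> i < j ->
  sigma_elt i j * x_elt k = x_elt k * sigma_elt i.+1 j.+1.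
Proof.
move=> ki ij; rewrite (@sigma_vine j) ?(@sigma_vine j.+1) ?(@x_vine j); [|lia..].
by rewrite vine_exchange_lt //; lia.
Qed.

Lemma tau_x_in i j k : 0 < i < j -> i <= k <= j - 2 ->
  tau_elt i j * x_elt k =
  x_elt (i + j - k - 2) * (tau_elt i j.+1 * sigma_elt k.+1 k.+2).
Proof.
case: j => [|m] ij ik; first lia.
rewrite !tau_vine (@sigma_vine m.+1) // ?(@x_vine m); [|lia..].
by apply: vine_exchange_in => //; lia.
Qed.

Lemma tau_x_first i j : 0 < i < j ->
  tau_elt i j * x_elt i.-1 = tau_elt i j.+1 * sigma_elt i i.+1.
Proof.
case: j => [|m] ij; first lia.
rewrite !tau_vine (@sigma_vine m.+1) ?(@x_vine m); [|lia..].
rewrite (@vine_exchange_in m i m.+1 m.+1); [|lia..].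
by rewrite vineX_last mul1g prednK //; lia.
Qed.

Lemma tau_x_left i j k : k.+1 < i -> i < j ->
  tau_elt i j * x_elt k = x_elt k * tau_elt i.+1 j.+1.
Proof.
case: j => [|m] ki ij; first lia.
by rewrite !tau_vine ?(@x_vine m) ?vine_exchange_lt //; lia.
Qed.

(** This is the exchange rule at p = i, whose mirror image is the last leaf j,
    where the caret is trivial. *)
Lemma tau_unfold i j : 0 < i < j ->
  tau_elt i j = x_elt i.-1 * (sigma_elt i i.+1 * tau_elt i j.+1).
Proof.
case: j => [|m] ij; first lia.
have := @vine_exchange_cs m i m.+1 i ij; rewrite gen_pos_in; last lia.
rewrite addKn vineX_last mulg1 gen_expand_in; last lia.
rewrite tau_vine => -> //; last lia.
by rewrite (@x_vine m) ?(@sigma_vine m.+1) ?prednK ?vineJM //; lia.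
Qed.

(** The right-hand side is tau_{i,j} expanded so that its bottom vine has
    j + m + 1 leaves: then leaf i of the top vine has grown into a right vine
    with m + 2 leaves, which is reversed by the sigma. *)
Lemma tau_unfold_iter i j m : 0 < i < j ->
  tau_elt i j = \prod_(i.-1 <= a < i + m) x_elt a *
                (sigma_elt i (i + m.+1) * tau_elt i (j + m.+1)).
Proof.
move=> ij; elim: m => [|m IHm].
  have -> : \prod_(i.-1 <= a < i + 0) x_elt a = x_elt i.-1.
    by rewrite addn0 -{2}(@prednK i) ?big_nat1 //; lia.
  by rewrite !addn1 -tau_unfold.
rewrite IHm (@tau_unfold i (j + m.+1)); last lia.
rewrite (mulgA (sigma_elt _ _)) sigma_x_in; [|lia..].
rewrite !prednK; [|lia..].
rewrite (_ : i + (i + m.+1) - i.-1 - 2 = i + m); last lia.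
rewrite -!mulgA (mulgA (sigma_elt i i.+1)) sigma_sq; last lia.
by rewrite mul1g !addnS big_nat_recr -?mulgA //=; lia.
Qed.

(** (D1) and (D2) at once.  Unfolding until the vine has k + 2 leaves hangs
    the caret of x_k from the last leaf but one of the bottom vine, so that (D3) and
    (C2) apply; the two short reversals that they produce cancel. *)
Lemma tau_x_right i j k : 0 < i < j -> j <= k.+1 ->
  tau_elt i j * x_elt k =
  \prod_(i.-1 <= a < (i + k - j).+1) x_elt a * x_elt (i + k - j) *
  (tau_elt i k.+3 * tau_elt j k.+3).
Proof.
move=> ij jk; rewrite (@tau_unfold_iter i j (k.+1 - j) ij) -!mulgA.
rewrite (_ : j + (k.+1 - j).+1 = k.+2); last lia.
rewrite (@tau_x_in i k.+2 k); [|lia..].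
rewrite (_ : i + k.+2 - k - 2 = i); last lia.
rewrite (mulgA (sigma_elt _ _)) (@sigma_x_in i _ i); [|lia..].
rewrite -!mulgA (@tau_sigma_nested i k.+3 k.+1 k.+2); [|lia..].
rewrite (_ : i + k.+3 - k.+2 = i.+1); last lia.
rewrite (_ : i + k.+3 - k.+1 = i.+2); last lia.
rewrite (mulgA (sigma_elt i.+1 _)) (@sigma_sq i.+1 i.+2); last lia.
rewrite mul1g.
rewrite (@tau_tau_nested i k.+3 j); [|lia..].
congr (_ * (x_elt _ * (sigma_elt _ _ * _))); try lia.
by congr (\prod_(_ <= _ < _) _); lia.
Qed.

Lemma word_eval_x i : word_eval cv_gen_elt (CVLetters.x i) = x_elt i.
Proof. exact: word_eval_gen. Qed.

Lemma word_eval_sigma i j : 0 < i < j ->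
  word_eval cv_gen_elt (CVLetters.sigma i j) = sigma_elt i j.
Proof. by move=> ij; rewrite /CVLetters.sigma insubT word_eval_gen. Qed.

Lemma word_eval_tau i j : 0 < i < j ->
  word_eval cv_gen_elt (CVLetters.tau i j) = tau_elt i j.
Proof. by move=> ij; rewrite /CVLetters.tau insubT word_eval_gen. Qed.

Lemma word_eval_xs a b :
  word_eval cv_gen_elt (CVLetters.xs a b) = \prod_(a <= m < b) x_elt m.
Proof.
rewrite /CVLetters.xs; elim: index_iota => [|m s IHs] /=.
  by rewrite big_nil word_eval_nil.
by rewrite -cat1s word_eval_cat word_eval_x IHs big_cons.
Qed.

Lemma cv_rel_holds u v : cv_rel u v ->
  word_eval cv_gen_elt u = word_eval cv_gen_elt v.
Proof.
case=> [i j|i j|i j|i j k l|i j k l|i j k|i j k l|i j l|i j k l|i j k|i j k|i j k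
  |i j k|i j|i j k|i j|i j k] h *;
  rewrite !word_eval_cat ?word_eval_nil ?word_eval_xs ?word_eval_x
    ?word_eval_sigma ?word_eval_tau; try lia; rewrite ?addn1 ?addn2 ?addn3.
- exact: x_x.
- exact: sigma_sq.
- exact: tau_sq.
- exact: sigma_sigma_disjoint.
- exact: sigma_sigma_nested.
- exact: tau_tau_nested.
- exact: sigma_tau_disjoint.
- exact: tau_sigma_left.
- exact: tau_sigma_nested.
- exact: sigma_x_right.
- by rewrite sigma_x_in //; lia.
- by rewrite sigma_x_left //; lia.
- rewrite tau_x_right; [|lia..].
  rewrite big_nat_recr /=; last lia.
  rewrite (_ : k - j + i = i + k - j) ?subn1 -?mulgA //; lia.
- rewrite tau_x_right ?subn1; [|lia..].
  rewrite (_ : i + j.-1 - j = i.-1) ?big_nat1; last lia.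
  by rewrite prednK -?mulgA //; lia.
- by rewrite tau_x_in //; lia.
- by rewrite subn1 tau_x_first.
- by rewrite tau_x_left //; lia.
Qed.

End Vines.

(** * The cactus groups in the presented group *)

Section Inverse.
Implicit Types (m n i j k p q : nat).

Definition xP i : presented cv_rel := pword cv_rel (CVLetters.x i).
Definition sigmaP i j : presented cv_rel := pword cv_rel (CVLetters.sigma i j).
Definition tauP i j : presented cv_rel := pword cv_rel (CVLetters.tau i j).

(** The letter that represents (V_n, s_{i,j}, V_n). *)
Definition csP n i j := if j < n then sigmaP i j else tauP i j.

(** The word that represents a caret added at leaf p of V_n; at the last leaf it
    only lengthens the vine. *)
Definition splitP n p := if p < n then xP p.-1 else 1.

Definition csP_gen n (a : cactus_gen n) := csP n (val a).1 (val a).2.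

Lemma word_eval_cactus_letter n i j : 0 < i < j -> j <= n ->
  word_eval (@csP_gen n) (cactus_letter n i j) = csP n i j.
Proof.
move=> ij jn; have [a va ->] := cactus_letterE ij jn.
by rewrite word_eval_gen /csP_gen va.
Qed.

Lemma cactus_rel_holds n (u v : word (cactus_gen n)) : cactus_rel u v ->
  word_eval (@csP_gen n) u = word_eval (@csP_gen n) v.
Proof.
case=> [i j ij jn|i j k l ij kl ln|i j k l ik kl jn];
  rewrite !word_eval_cat ?word_eval_nil ?word_eval_cactus_letter; try lia;
  rewrite /csP.
- by case: ifP => _; rewrite -pword_cat; apply: pword_rel; constructor.
- rewrite (_ : j < n); last lia.
  by case: ifP => _; rewrite -!pword_cat; apply: pword_rel; constructor.
have [j_lt|n_le] := ltnP j n.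
  rewrite (_ : l < n) 1?(_ : i + j - k < n); [|lia..].
  by rewrite -!pword_cat; apply: pword_rel; constructor.
have jE : j = n by lia.
(* the four cases are (B6), (B7), a tautology and (B4) *)
have [l_lt|n_le'] := ltnP l n; have [ki|ki] := eqVneq k i.
- rewrite ki (_ : i + j - i < n = false); last lia.
  rewrite (_ : i + j - i = j); last lia.
  by rewrite -!pword_cat; apply: pword_rel; constructor; lia.
- rewrite (_ : i + j - k < n); last lia.
  by rewrite -!pword_cat; apply: pword_rel; constructor; lia.
- rewrite (_ : i + j - k < n = false); last lia.
  by congr (pword _ (CVLetters.tau _ _) * pword _ (CVLetters.tau _ _)); lia.
rewrite (_ : i + j - k < n); last lia.
rewrite (_ : l = j) ?addnK; last lia.
by rewrite -!pword_cat; apply: pword_rel; constructor; lia.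
Qed.

Definition JP n : J n -> presented cv_rel := presented_lift (@csP_gen n).

Lemma JPM n : {morph @JP n : s t / s * t}.
Proof. exact: presented_liftM (@cactus_rel_holds n). Qed.

Lemma JP1 n : @JP n 1 = 1.
Proof. exact: presented_lift1 (@cactus_rel_holds n). Qed.

Lemma JP_cs n i j : 0 < i < j -> j <= n -> JP (cs n i j) = csP n i j.
Proof.
move=> ij jn; rewrite /JP presented_lift_word ?word_eval_cactus_letter //.
exact: cactus_rel_holds.
Qed.

(** For j = n and q = n there is no x on the left, and the equality is (D4)
    solved for tau_{i,j} by means of (B1) and (B4). *)
Lemma JP_exchange_in n i j p q : 0 < i < j -> j <= n -> i <= p <= j ->
  p + q = i + j ->
  csP n i j * splitP n q = splitP n p * (csP n.+1 i j.+1 * csP n.+1 q q.+1).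
Proof.
move=> ij jn ip pq; rewrite /csP /splitP ltnS !ltnS.
have [j_lt|n_le] := ltnP j n.
  rewrite (_ : q < n) 1?(_ : p < n); [|lia..].
  have := pword_rel (@cv_relC2 i j q.-1 ij ltac:(lia)); rewrite !pword_cat !addn1 addn2.
  rewrite prednK; last lia.
  by rewrite (_ : i + j - q.-1 - 2 = p.-1) //; lia.
have jE : j = n by lia.
have [q_lt|n_le'] := ltnP q n; last first.
  rewrite (_ : p < n) 1?(_ : q = j) 1?(_ : p = i) -?jE; [|lia..].
  have relD4 := pword_rel (@cv_relD4 i j ij).
  rewrite !pword_cat !addn1 subn1 in relD4.
  have := pword_rel (@cv_relB4 i j.+1 j ij (leqnn _)); rewrite !pword_cat => ->.
  rewrite (_ : i + j.+1 - j = i.+1); last lia.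
  (* q = j = n and p = i: after multiplication by tau_{i,j} both sides are 1 *)
  apply: (@mulgI _ (tauP i j)); rewrite mulg1 !mulgA relD4 -/(tauP _ _).
  have := pword_rel (@cv_relB1_tau i j ij); rewrite pword_cat => ->.
  have := pword_rel (@cv_relB1_sigma i i.+1 ltac:(lia)); rewrite pword_cat => sigmaK.
  rewrite -(mulgA (tauP i j.+1)) sigmaK.
  by rewrite mulg1 -pword_cat (pword_rel (cv_relB1_tau _)) //; lia.
have [p_lt|n_le'] := ltnP p n; last first.
  rewrite (_ : q = i) ?mul1g; last lia.
  by have := pword_rel (@cv_relD4 i j ij); rewrite !pword_cat !addn1 subn1.
have := pword_rel (@cv_relD3 i j q.-1 ij ltac:(lia)); rewrite !pword_cat !addn1 addn2.
rewrite prednK; last lia.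
by rewrite (_ : i + j - q.-1 - 2 = p.-1) //; lia.
Qed.

Lemma JP_exchange_gen n i j p : 0 < i < j -> j <= n -> 0 < p <= n ->
  csP n i j * splitP n (gen_pos (i, j) p) =
  splitP n p * JP (gen_expand n (i, j) p).
Proof.
move=> ij jn pn; have [pi|ip] := ltnP p i.
  gens; rewrite JP_cs /splitP /csP ?ltnS; [|lia..].
  rewrite (_ : p < n); last lia.
  case: ifP => _.
    have := pword_rel (@cv_relC3 i j p.-1 ltac:(lia) ltac:(lia)); by rewrite !pword_cat !addn1.
  have := pword_rel (@cv_relD5 i j p.-1 ltac:(lia) ltac:(lia)); by rewrite !pword_cat !addn1.
have [pj|jp] := leqP p j.
  gens; rewrite (@JP_exchange_in n i j p); [|lia..].
  congr (_ * _); rewrite -!JP_cs; [|lia..].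
  rewrite -!JPM cs_nested; [|lia..].
  rewrite (_ : i + j.+1 - (i + j - p).+1 = p); last lia.
  by rewrite (_ : i + j.+1 - (i + j - p) = p.+1); last lia.
gens; rewrite JP_cs /splitP /csP; [|lia..].
rewrite (_ : j < n) 1?(_ : j < n.+1); [|lia..].
case: ifP => _; last by rewrite mulg1 mul1g.
by have := pword_rel (@cv_relC1 i j p.-1 ij ltac:(lia)); rewrite !pword_cat.
Qed.

Lemma JP_exchange n (s : J n) p : 0 < p <= n ->
  JP s * splitP n (Jpos s p) = splitP n p * JP (Jexpand s p).
Proof.
elim/J_ind: s p => [|i j s ij jn IHs] p pn.
  by rewrite Jpos1 Jexpand1 !JP1 mulg1 mul1g.
have qn : 0 < gen_pos (i, j) p <= n.
  by rewrite -(Jpos_cs _ ij jn) Jpos_bound.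
rewrite JposM JexpandM !JPM Jpos_cs // Jexpand_cs // JP_cs //.
by rewrite -mulgA IHs // !mulgA JP_exchange_gen.
Qed.

(** * Words of trees *)

(** The product of the x's that grow T out of leaf k + 1 of a vine, this leaf not
    being the last one. *)
Fixpoint inner_carets (T : btree) k : presented cv_rel :=
  if T is Node l r then
    xP k * (inner_carets l k * inner_carets r (k + leaves l))
  else 1.

(** The same when T grows out of the last leaf, so that the carets on the right
    spine of T only lengthen the vine and contribute nothing. *)
Fixpoint spine_carets (T : btree) k : presented cv_rel :=
  if T is Node l r then inner_carets l k * spine_carets r (k + leaves l) else 1.

Definition treeP (T : btree) := spine_carets T 0.

Lemma xP_xP i j : i < j -> xP j * xP i = xP i * xP j.+1.
Proof. by move=> /cv_relA/pword_rel; rewrite !pword_cat addn1. Qed.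

(** A caret added to the left of T moves T one leaf to the right. *)
Lemma inner_carets_shift T i k : i < k ->
  xP i * inner_carets T k.+1 = inner_carets T k * xP i.
Proof.
elim: T k => [|l IHl r IHr] k ik /=; first by rewrite mulg1 mul1g.
rewrite (mulgA (xP i)) -xP_xP // -!mulgA; congr (_ * _).
rewrite (mulgA (xP i)) IHl // -!mulgA.
by rewrite addSn IHr //; lia.
Qed.

Lemma spine_carets_shift T i k : i < k ->
  xP i * spine_carets T k.+1 = spine_carets T k * xP i.
Proof.
elim: T k => [|l IHl r IHr] k ik /=; first by rewrite mulg1 mul1g.
rewrite (mulgA (xP i)) inner_carets_shift // -!mulgA addSn IHr //; lia.
Qed.

Lemma inner_carets_attach T k i : 0 < i <= leaves T ->
  inner_carets (attach_caret T i) k = inner_carets T k * xP (k + i).-1.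
Proof.
elim: T k i => [|l IHl r IHr] k i /= iT.
  by rewrite (_ : (k + i).-1 = k) ?mulg1 ?mul1g //; lia.
have [il|li] := leqP i (leaves l) => /=.
  rewrite IHl ?leaves_attach ?addnS -?mulgA ?inner_carets_shift //; lia.
rewrite IHr -?mulgA; last lia.
by rewrite (_ : k + leaves l + (i - leaves l) = k + i) //; lia.
Qed.

Lemma spine_carets_attach T k i : 0 < i <= leaves T ->
  spine_carets (attach_caret T i) k =
  spine_carets T k * (if i < leaves T then xP (k + i).-1 else 1).
Proof.
elim: T k i => [|l IHl r IHr] k i /= iT.
  by rewrite ltnNge (_ : 0 < i) ?mulg1 //; lia.
have r0 := leaves_gt0 r.
have [il|li] := leqP i (leaves l) => /=.
  rewrite inner_carets_attach ?leaves_attach ?addnS; last lia.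
  rewrite (_ : i < leaves l + leaves r) -?mulgA ?spine_carets_shift //; lia.
rewrite IHr -?mulgA; last lia.
rewrite (_ : k + leaves l + (i - leaves l) = k + i); last lia.
by rewrite (_ : (i - leaves l < leaves r) = (i < leaves l + leaves r)) //; lia.
Qed.

Lemma treeP_attach n (T : tree n) i : 0 < i <= n ->
  treeP (attach T i) = treeP T * splitP n i.
Proof. by move=> iT; rewrite /treeP /= spine_carets_attach leaves_tree. Qed.

Lemma treeP_vine m : treeP (right_vine m) = 1.
Proof.
elim: m => // m IHm; rewrite -[right_vine m.+1]/(attach (right_vine m) m.+1).
rewrite treeP_attach ?leqnn // IHm mul1g.
by rewrite /splitP ltnn.
Qed.

(** * The inverse map *)

Definition pairP (a : cactus_pair) : presented cv_rel :=
  treeP (pair_top a) * JP (pair_elt a) * (treeP (pair_bot a))^-1.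

(** The carets added to the two trees and the expansion of s cancel by the
    exchange rule in the presented group. *)
Lemma pairP_expand1 a i : 0 < i <= pair_size a -> pairP (expand1 a i) = pairP a.
Proof.
case: a => n A s B /= iA; rewrite /pairP /= -!/(attach _ _) !treeP_attach //.
  rewrite -(mulgA (treeP A)) -JP_exchange // invgM !mulgA.
  by rewrite mulgK.
exact: Jpos_bound.
Qed.

Lemma pairP_equiv a b : cv_equiv a b -> pairP a = pairP b.
Proof.
elim=> {a b} [a b /expansionP[i ia ->]|//|a b _ -> //|a b c _ -> _ -> //].
by rewrite pairP_expand1.
Qed.

Definition cvP (c : CV) : presented cv_rel := pairP (repr c).

Lemma cvP_cv n (A B : tree n) (s : J n) :
  cvP (cv A s B) = treeP A * JP s * (treeP B)^-1.
Proof.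
by rewrite -[RHS]/(pairP (CactusPair A s B)); apply/pairP_equiv/cv_classP/reprK.
Qed.

Lemma cvPM : {morph cvP : c d / c * d}.
Proof.
move=> c d; have [e cde] := cv_prod_ex c d.
have <- : e = c * d by apply/cv_mulP.
case: cde => [n [A [B [C [s [t [-> -> ->]]]]]]].
by rewrite !cvP_cv JPM !mulgA mulgVK.
Qed.

Lemma cvP_gen g : cvP (cv_gen_elt g) = pgen cv_rel g.
Proof.
case: g => [i|[[i j] /= ij]|[[i j] /= ij]] /=.
- rewrite /x_elt cvP_cv treeP_attach //; last by rewrite leqnSn.
  rewrite /R !treeP_vine JP1 invg1 !mulg1 mul1g /splitP ifT //.
- rewrite /sigma_elt cvP_cv /R treeP_vine invg1 mulg1 mul1g JP_cs //.
  by rewrite /csP ifT // /sigmaP /CVLetters.sigma insubT.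
rewrite /tau_elt cvP_cv /R treeP_vine invg1 mulg1 mul1g JP_cs //; last lia.
rewrite /csP ifF; last lia.
by rewrite /tauP /CVLetters.tau insubT.
Qed.

Definition toCV : presented cv_rel -> CV := presented_lift cv_gen_elt.

Lemma toCVM : {morph toCV : g h / g * h}.
Proof. exact: presented_liftM cv_rel_holds. Qed.

Lemma toCV1 : toCV 1 = 1.
Proof. exact: presented_lift1 cv_rel_holds. Qed.

HB.instance Definition _ :=
  isUMagmaMorphism.Build (presented cv_rel) CV toCV (conj toCV1 toCVM).

Lemma toCV_gen g : toCV (pgen cv_rel g) = cv_gen_elt g.
Proof. exact: presented_lift_gen cv_rel_holds g. Qed.

Lemma toCV_word u : toCV (pword cv_rel u) = word_eval cv_gen_elt u.
Proof. exact: presented_lift_word cv_rel_holds u. Qed.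

Lemma toCV_splitP m p : 0 < p <= m.+1 -> toCV (splitP m.+1 p) = vineX m p.
Proof.
move=> pm; rewrite /splitP; case: ltnP => h.
  by rewrite toCV_word word_eval_x (@x_vine m) ?prednK //; lia.
by rewrite toCV1 (_ : p = m.+1) ?vineX_last //; lia.
Qed.

Lemma toCV_csP m i j : 0 < i < j -> j <= m.+1 ->
  toCV (csP m.+1 i j) = vineJ (cs m.+1 i j).
Proof.
move=> ij jm; rewrite /csP; case: ltnP => h.
  by rewrite toCV_word word_eval_sigma // (@sigma_vine m).
by rewrite toCV_word word_eval_tau // (_ : j = m.+1) //; lia.
Qed.

Lemma toCV_JP m (s : J m.+1) : toCV (JP s) = vineJ s.
Proof.
elim/J_ind: s => [|i j s ij jm IHs].
  by rewrite JP1 vineJ1 toCV1.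
by rewrite JPM vineJM toCVM IHs JP_cs // toCV_csP.
Qed.

(** Every tree grows from a single vertex by adding carets.  Structural
    induction would not do for facts on [treeP], whose values on the subtrees of T
    are not factors of its value on T. *)
Lemma attach_caret_ind (Q : btree -> Prop) : Q Leaf ->
  (forall T i, 0 < i <= leaves T -> Q T -> Q (attach_caret T i)) ->
  forall T, Q T.
Proof.
move=> QL QA T; have : tle Leaf T by [].
move: {1 2}Leaf QL => A QA' AT.
have [k] := ubnP (leaves T - leaves A); elim: k A QA' AT => // k IHk A qA AT lt.
have [<- //|ne] := EM (A = T); have [i iA iT] := tle_step AT ne.
apply: (IHk _ (QA _ _ iA qA) iT).
by have := tle_leaves iT; rewrite leaves_attach; lia.
Qed.

Lemma toCV_treeP m (T : tree m.+1) : toCV (treeP T) = cv T 1 (right_vine m).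
Proof.
case: T => T; elim/attach_caret_ind: T m => [|T i iT IHT] m Tm.
  have m0 : m = 0 by case: Tm.
  rewrite {m}m0 in Tm *.
  rewrite (_ : Tree Tm = leaf) ?cv1; last exact: tree_inj.
  by rewrite toCV1.
have Tm' := Tm; rewrite leaves_attach in Tm'; case: Tm' => Tm'.
case: m Tm Tm' => [|m] Tm Tm'; first by have := leaves_gt0 T; lia.
have -> : Tree Tm = attach (Tree Tm') i by apply: tree_inj.
have im : 0 < i <= m.+1 by rewrite -Tm'.
by rewrite treeP_attach // toCVM (IHT _ Tm') toCV_splitP // cv_vineX.
Qed.

Lemma toCVK : cancel toCV cvP.
Proof.
move=> g; apply: (@presented_hom_eq _ _ _ (cvP \o toCV) id) => //.
  by move=> a b /=; rewrite toCVM cvPM.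
by move=> x /=; rewrite toCV_gen cvP_gen.
Qed.

Lemma cvPK : cancel cvP toCV.
Proof.
move=> c; have [[|m] [A [B [s ->]]]] := cv_surj c.
  by have := leaves_gt0 A; rewrite leaves_tree.
have toCVV g : toCV g^-1 = (toCV g)^-1 := gmulfV toCV g.
rewrite cvP_cv !toCVM toCVV !toCV_treeP toCV_JP cvV invg1 !cvM.
by rewrite mul1g mulg1.
Qed.

End Inverse.

Theorem theorem4p4 :
  exists phi : {multiplicative presented cv_rel -> CV},
    bijective phi /\ forall g : cv_gen, phi (pgen cv_rel g) = cv_gen_elt g.
Proof.
exists toCV; split; last exact: toCV_gen.
exact: Bijective toCVK cvPK.
Qed.
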